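(* Let $M$ be a connected Kähler manifold of real dimension $2m$, $m\ge 2$. Then $M$ has constant holomorphic sectional curvature if one of the following conditions holds: (a) $M$ satisfies the axiom of special holomorphic $2r$-submanifolds for some $1\le r\le m-1$; (b) $M$ satisfies the axiom of special antiholomorphic $r$-submanifolds for some $2\le r\le m$. Conversely, all complex and all totally real isometric immersions in a Kähler manifold of constant holomorphic sectional curvature are very special.
   Context: $M$ has almost complex structure $J$, Levi-Civita connection $\bar\nabla$ and curvature tensor $\bar R(X,Y)=\bar\nabla_X\bar\nabla_Y-\bar\nabla_Y\bar\nabla_X-\bar\nabla_{[X,Y]}$. A linear subspace $W\subset T_pM$ is holomorphic if $JW=W$, and antiholomorphic if $JW\perp W$. For an isometric immersion $f:S\to M$ we identify $T_pS$ with its image $df_p(T_pS)$ in the tangent space of $M$. The immersion is complex if every $T_pS$ is holomorphic, and totally real if every $T_pS$ is antiholomorphic. The immersion $f$ is called special if for every $p\in S$ and every orthonormal basis $v_1,\dots,v_k$ of $T_pS$ one has $\sum_i\bar R(v_i,w)v_i\in T_pS$ for all $w\in T_pS$. It is called very special if for every $p\in S$ and all $v,w\in T_pS$ one has $\bar R(v,w)v\in T_pS$. A submanifold is special if its inclusion, with the induced metric, is a special isometric immersion. For $1\le r\le m-1$, $M$ satisfies the axiom of special holomorphic $2r$-submanifolds if for every $p\in M$ and every holomorphic linear subspace $W\subset T_pM$ of real dimension $2r$ there exists a special submanifold $S$ of $M$ containing $p$ with $T_pS=W$. For $2\le r\le m$, $M$ satisfies the axiom of special antiholomorphic $r$-submanifolds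 if for every $p\in M$ and every antiholomorphic linear subspace $W\subset T_pM$ of real dimension $r$ there exists a special submanifold $S$ of $M$ containing $p$ with $T_pS=W$. *)

(* Defs.v *)
From HB Require Import structures.
From mathcomp Require Import all_boot all_order all_algebra.
From mathcomp Require Import boolp classical_sets functions reals.
From mathcomp Require Import topology normedtype derive.

Set Implicit Arguments.
Unset Strict Implicit.
Unset Printing Implicit Defensive.

Import Order.TTheory GRing.Theory Num.Theory.
Import numFieldNormedType.Exports.

Local Open Scope classical_set_scope.
Local Open Scope ring_scope.

(* Differential geometry on manifolds given by atlases. A tensor field is
   given by its components in every chart, as functions of the coordinates;
   a tangent vector at [p] is the row vector of its components in a chart
   around [p]. Linear subspaces of a tangent space are row spaces of matrices
   (scope [%MS]), and endomorphisms act on row vectors from the right. *)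

Section Smooth.
Context {R : realType} {n : nat} {V : normedModType R}.
Implicit Types (U : set 'rV[R]_n) (f : 'rV[R]_n -> V).

(* meaningful for open [U] only *)
Fixpoint class_C (k : nat) U f : Prop :=
  if k is k'.+1 then
    (forall x, U x -> differentiable f x) /\
    (forall v, class_C k' U ('D_v f))
  else forall x, U x -> {for x, continuous f}.

Definition smooth U f : Prop := forall k, class_C k U f.

End Smooth.

Record manifold (R : realType) (n : nat) := Manifold {
  carrier :> topologicalType;
  index : Type;
  dom : index -> set carrier;
  chart : index -> carrier -> 'rV[R]_n;
  unchart : index -> 'rV[R]_n -> carrier;
  manifold_hausdorff : hausdorff_space carrier;
  manifold_second_countable : @second_countable carrier;
  dom_cover : forall p, exists i, dom i p;
  dom_open : forall i, open (dom i);
  cod_open : forall i, open (chart i @` dom i);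
  chartK : forall i p, dom i p -> unchart i (chart i p) = p;
  chart_continuous : forall i p, dom i p -> {for p, continuous (chart i)};
  unchart_continuous : forall i p, dom i p ->
    {for chart i p, continuous (unchart i)};
  transition_smooth : forall i j,
    smooth (chart i @` (dom i `&` dom j)) (chart j \o unchart i)
}.

Arguments dom {R n m}.
Arguments chart {R n m}.
Arguments unchart {R n m}.

Section Transition.
Context {R : realType} {n : nat} {M : manifold R n}.
Implicit Types (i j : index M) (p : M).

Definition cod i : set 'rV[R]_n := chart i @` dom i.

Definition transition i j : 'rV[R]_n -> 'rV[R]_n := chart j \o unchart i.

(* from the components in chart [i] of a tangent vector at [p] to those in
   chart [j] *)
Definition change i j p : 'M[R]_n := 'J (transition i j) (chart i p).

End Transition.

Definition bilin (R : realType) (n : nat) (g : 'M[R]_n) (u v : 'rV[R]_n) : R :=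
  (u *m g *m v^T) 0 0.

Record riemannian (R : realType) (n : nat) := Riemannian {
  riem_manifold :> manifold R n;
  metric : index riem_manifold -> 'rV[R]_n -> 'M[R]_n;
  metric_smooth : forall i, smooth (cod i) (metric i);
  metric_sym : forall i x, cod i x -> forall u v,
    bilin (metric i x) u v = bilin (metric i x) v u;
  metric_pos : forall i x, cod i x -> forall u, u != 0 ->
    0 < bilin (metric i x) u u;
  metric_change : forall i j p, dom i p -> dom j p -> forall u v,
    bilin (metric j (chart j p)) (u *m change i j p) (v *m change i j p) =
    bilin (metric i (chart i p)) u v
}.

Arguments metric {R n r}.

Definition christ_sum (R : realType) (n : nat)
    (G : 'I_n -> 'I_n -> 'rV[R]_n -> 'rV[R]_n)
    (x u v : 'rV[R]_n) : 'rV[R]_n :=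
  \sum_a \sum_b (u 0 a * v 0 b) *: G a b x.

(* [christoffel i a b x] is the vector nabla_{d_a} d_b at [x], where d_a, d_b
   are coordinate fields of chart [i]; the last field is the transformation
   law of Christoffel symbols. *)
Record connection (R : realType) (n : nat) (M : manifold R n) := Connection {
  christoffel : index M -> 'I_n -> 'I_n -> 'rV[R]_n -> 'rV[R]_n;
  christoffel_smooth : forall i a b, smooth (cod i) (christoffel i a b);
  christoffel_change : forall i j p, dom i p -> dom j p -> forall u v,
    'D_u ('D_v (transition i j)) (chart i p) +
      christ_sum (christoffel j) (chart j p)
        (u *m change i j p) (v *m change i j p) =
    christ_sum (christoffel i) (chart i p) u v *m change i j p
}.

Section VectorFields.
Context {R : realType} {n : nat} {M : manifold R n} (D : connection M).
Implicit Types (i : index M) (X Y Z : 'rV[R]_n -> 'rV[R]_n).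
Implicit Types (x u v w : 'rV[R]_n).

Definition nabla i X Y : 'rV[R]_n -> 'rV[R]_n :=
  fun x => 'D_(X x) Y x + christ_sum (christoffel D i) x (X x) (Y x).

Definition lie_bracket X Y : 'rV[R]_n -> 'rV[R]_n :=
  fun x => 'D_(X x) Y x - 'D_(Y x) X x.

Definition curvature_field i X Y Z : 'rV[R]_n -> 'rV[R]_n :=
  fun x => nabla i X (nabla i Y Z) x - nabla i Y (nabla i X Z) x
           - nabla i (lie_bracket X Y) Z x.

(* The curvature is tensorial, so tangent vectors may be extended to fields
   with constant components. *)
Definition curvature i x u v w : 'rV[R]_n :=
  curvature_field i (cst u) (cst v) (cst w) x.

End VectorFields.

Definition levi_civita (R : realType) (n : nat) (M : riemannian R n)
    (D : connection M) : Prop :=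
  forall i X Y, smooth (cod i) X -> smooth (cod i) Y ->
  (forall x, cod i x ->
     nabla D i X Y x - nabla D i Y X x = lie_bracket X Y x) /\
  (forall Z, smooth (cod i) Z -> forall x, cod i x ->
     'D_(X x) (fun y => bilin (metric i y) (Y y) (Z y)) x =
     bilin (metric i x) (nabla D i X Y x) (Z x) +
     bilin (metric i x) (Y x) (nabla D i X Z x)).

(* [n] is the real dimension. The field [lc] adds no data: a Riemannian
   manifold has exactly one Levi-Civita connection. *)
Record kahler (R : realType) (n : nat) := Kahler {
  kahler_riem :> riemannian R n;
  lc : connection kahler_riem;
  lcP : levi_civita lc;
  cplx : index kahler_riem -> 'rV[R]_n -> 'M[R]_n;
  cplx_smooth : forall i, smooth (cod i) (cplx i);
  cplx_change : forall i j p, dom i p -> dom j p ->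
    cplx i (chart i p) *m change i j p = change i j p *m cplx j (chart j p);
  cplx_sqr : forall i x, cod i x -> cplx i x *m cplx i x = - 1%:M;
  cplx_hermitian : forall i x, cod i x -> forall u v,
    bilin (metric i x) (u *m cplx i x) (v *m cplx i x) =
    bilin (metric i x) u v;
  cplx_parallel : forall i X Y, smooth (cod i) X -> smooth (cod i) Y ->
    forall x, cod i x ->
    nabla lc i X (fun y => Y y *m cplx i y) x = nabla lc i X Y x *m cplx i x
}.

Arguments lc {R n}.
Arguments cplx {R n k}.

Section KahlerPoint.
Context {R : realType} {n : nat} {M : kahler R n}.
Implicit Types (i : index M) (p : M) (u v w : 'rV[R]_n).

Definition inner i p u v : R := bilin (metric i (chart i p)) u v.

Definition Jmx i p : 'M[R]_n := cplx i (chart i p).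

Definition Rm i p u v w : 'rV[R]_n := curvature (lc M) i (chart i p) u v w.

Definition sectional i p u v : R :=
  inner i p (Rm i p u v v) u /
  (inner i p u u * inner i p v v - inner i p u v ^+ 2).

Definition holomorphic i p (k : nat) (W : 'M[R]_(k, n)) : Prop :=
  (W *m Jmx i p == W)%MS.

Definition antiholomorphic i p (k : nat) (W : 'M[R]_(k, n)) : Prop :=
  forall u v, (u <= W)%MS -> (v <= W)%MS -> inner i p (u *m Jmx i p) v = 0.

End KahlerPoint.

Definition constant_holomorphic_curvature (R : realType) (n : nat)
    (M : kahler R n) : Prop :=
  exists c : R, forall (i : index M) (p : M), dom i p ->
  forall u : 'rV[R]_n, u != 0 -> sectional i p u (u *m Jmx i p) = c.

Section Immersions.
Context {R : realType} {k n : nat}.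

Section Maps.
Context {S : manifold R k} {M : manifold R n} (f : S -> M).

Definition local_rep (a : index S) (i : index M) : 'rV[R]_k -> 'rV[R]_n :=
  chart i \o f \o unchart a.

Definition smooth_map : Prop :=
  continuous f /\
  forall a i, smooth (chart a @` (dom a `&` f @^-1` dom i)) (local_rep a i).

(* Jacobian matrix at [q]; its row space is the tangent space of [S] at [q],
   identified with its image under df. *)
Definition dmap (a : index S) (i : index M) (q : S) : 'M[R]_(k, n) :=
  'J (local_rep a i) (chart a q).

(* [f] is injective and a homeomorphism onto its image *)
Definition topological_embedding : Prop :=
  injective f /\
  forall U : set S, open U ->
    exists2 V : set M, open V & f @` U = range f `&` V.

End Maps.

(* Preserving a metric makes df injective, hence [f] an immersion. *)
Definition isometric_immersion (S : riemannian R k) (M : riemannian R n)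
    (f : S -> M) : Prop :=
  smooth_map f /\
  forall a i q, dom a q -> dom i (f q) -> forall u v : 'rV[R]_k,
    bilin (metric i (chart i (f q))) (u *m dmap f a i q) (v *m dmap f a i q) =
    bilin (metric a (chart a q)) u v.

Context {S : riemannian R k} {M : kahler R n} (f : S -> M).

Definition complex_immersion : Prop :=
  forall a i q, dom a q -> dom i (f q) -> holomorphic i (f q) (dmap f a i q).

Definition totally_real : Prop :=
  forall a i q, dom a q -> dom i (f q) ->
  antiholomorphic i (f q) (dmap f a i q).

Definition special : Prop :=
  forall a i q, dom a q -> dom i (f q) ->
  forall v : 'I_k -> 'rV[R]_n,
    (\matrix_(s < k) v s == dmap f a i q)%MS ->
    (forall s t, inner i (f q) (v s) (v t) = (s == t)%:R) ->
  forall w : 'rV[R]_n, (w <= dmap f a i q)%MS ->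
    ((\sum_(s < k) Rm i (f q) (v s) w (v s))%R <= dmap f a i q)%MS.

Definition very_special : Prop :=
  forall a i q, dom a q -> dom i (f q) ->
  forall v w : 'rV[R]_n, (v <= dmap f a i q)%MS -> (w <= dmap f a i q)%MS ->
    (Rm i (f q) v w v <= dmap f a i q)%MS.

End Immersions.

(* A submanifold with its induced metric is a Riemannian manifold [S] with an
   isometric embedding [f], the inclusion. *)
Definition special_submanifold_tangent (R : realType) (k n : nat)
    (M : kahler R n) (i : index M) (p : M) (W : 'M[R]_n) : Prop :=
  exists (S : riemannian R k) (f : S -> M),
    [/\ isometric_immersion f, topological_embedding f, special f &
        exists q, f q = p /\
          forall a, dom a q -> (dmap f a i q == W)%MS].

Definition axiom_special_holomorphic (R : realType) (n : nat)
    (M : kahler R n) (r : nat) : Prop :=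
  forall (p : M) (i : index M), dom i p ->
  forall W : 'M[R]_n, \rank W = (2 * r)%N -> holomorphic i p W ->
    special_submanifold_tangent (2 * r) i p W.

Definition axiom_special_antiholomorphic (R : realType) (n : nat)
    (M : kahler R n) (r : nat) : Prop :=
  forall (p : M) (i : index M), dom i p ->
  forall W : 'M[R]_n, \rank W = r -> antiholomorphic i p W ->
    special_submanifold_tangent r i p W.

(* Main.v *)
Require Import Defs.
From mathcomp Require Import all_boot all_order all_algebra.
From mathcomp Require Import boolp classical_sets functions reals.
From mathcomp Require Import topology normedtype derive.
From mathcomp Require Import ring lra zify.

(** The curvature of a Kähler manifold at a point is a tensor
    T(a,b,c,d) = <R(a,b)c,d> that has the symmetries of a Riemannian curvature
    tensor and satisfies T(a,b,Jc,Jd) = T(a,b,c,d). Such a tensor is determined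
    by the quartic form F(v) = T(Jv,v,Jv,v), because F = 0 forces T = 0
    ([bisec_eq0]), so everything is about showing that F(v) = c |v|^4 for a
    constant c, which means that T is a multiple of an explicit model tensor
    ([model_curv_unique]).

    At one point. Write Q(a,b,c,d) = T(Ja,b,Jc,d). If a special submanifold is
    tangent to W, then for an orthonormal basis (v_s) of W, for w in W and z
    orthogonal to W, the sum of T(v_s,w,v_s,z) vanishes. Choose W spanned by a
    unitary frame and its images under J in case (a), and by a unitary frame
    with one vector replaced by its image under J in case (b), where the choices
    y and Jy for the remaining vectors are averaged. Both cases give, for every
    unitary frame e, x, y_1, ..., y_N, one identity
        al Q(e,e,e,x) + sum_j Q(y_j,y_j,e,x) = 0,
    with al = 1 in case (a) and al = 2 in case (b). Exchanging e and x shows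
    that Q(e,e,e,x) = Q(x,x,x,e); rotating (e,x) in its real span then expresses
    the bisectional curvature Q(e,e,x,x) through F(e) + F(x). Rotating by 45
    degrees with the y_j fixed turns the identity into
    (al + N/2) (F(x) - F(e)) = 0, hence F(e) = F(x), and finally
    Q(e,e,e,x) = 0 ([frame_q3_eq0]). This says that the gradient of F at v is
    proportional to v, so F is constant on the unit sphere ([bisec_constant]).

    Over the manifold. All geometry is done in a chart, with the Christoffel
    symbols packed into matrices conn_mx u acting on row vectors. The curvature
    is then the matrix curv_mx u v, and its symmetries, its commutation with J,
    its behaviour under a change of charts ([curv_mx_change]) and the second
    Bianchi identity ([bianchi2]) are matrix identities obtained by
    differentiating one relation and using that second derivatives commute
    ([schwarz]). If the curvature is k(x) times the model tensor, then, the model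
    tensor being parallel, the second Bianchi identity becomes a cyclic sum of
    dk(u) times model tensors; evaluated on a vector orthogonal to u and Ju it
    gives dk = 0 ([schur]). Connectedness makes k constant ([kahler_schur]).

    Conversely, for the model tensor R(v,w)v is a combination of v, w and
    <Jw,v> Jv, which lies in W if W is holomorphic, and also if W is
    antiholomorphic because the last coefficient is then zero
    ([constant_very_special]). *)

Set Implicit Arguments.
Unset Strict Implicit.
Unset Printing Implicit Defensive.
Import Order.TTheory GRing.Theory Num.Theory.
Import numFieldNormedType.Exports.
Local Open Scope classical_set_scope.
Local Open Scope ring_scope.

(** * Kähler curvature tensors on a Hermitian vector space *)

Record hermitian_space (R : rcfType) (V : lmodType R) (ip : V -> V -> R)
    (J : V -> V) : Prop := HermitianSpace {
  ip_linear : forall a u v w, ip (a *: u + v) w = a * ip u w + ip v w;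
  ip_sym : forall u v, ip u v = ip v u;
  ip_pos : forall u, u != 0 -> 0 < ip u u;
  J_linear : forall a u v, J (a *: u + v) = a *: J u + J v;
  JJ : forall u, J (J u) = - u;
  ip_JJ : forall u v, ip (J u) (J v) = ip u v
}.

Record kahler_tensor (R : rcfType) (V : lmodType R) (J : V -> V)
    (T : V -> V -> V -> V -> R) : Prop := KahlerTensor {
  T_linear : forall k a a' b c d,
    T (k *: a + a') b c d = k * T a b c d + T a' b c d;
  T_anti12 : forall a b c d, T a b c d = - T b a c d;
  T_anti34 : forall a b c d, T a b c d = - T a b d c;
  T_bianchi : forall a b c d, T a b c d + T b c a d + T c a b d = 0;
  T_J34 : forall a b c d, T a b (J c) (J d) = T a b c d
}.

Section Tensor.
Context {R : rcfType} {V : lmodType R} {ip : V -> V -> R} {J : V -> V}.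
Context (H : hermitian_space ip J).
Implicit Types (a b c d e u v w x y z : V) (k : R).

Lemma ipDl u v w : ip (u + v) w = ip u w + ip v w.
Proof. by rewrite -[u]scale1r (ip_linear H) mul1r scale1r. Qed.
Lemma ip0l w : ip 0 w = 0.
Proof. by apply: (addrI (ip 0 w)); rewrite -ipDl !addr0. Qed.
Lemma ipZl k u w : ip (k *: u) w = k * ip u w.
Proof. by rewrite -[k *: u]addr0 (ip_linear H) ip0l addr0. Qed.
Lemma ipNl u w : ip (- u) w = - ip u w.
Proof. by rewrite -scaleN1r ipZl mulN1r. Qed.
Lemma ipDr u v w : ip w (u + v) = ip w u + ip w v.
Proof. by rewrite (ip_sym H) ipDl !(ip_sym H w). Qed.
Lemma ipZr k u w : ip w (k *: u) = k * ip w u.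
Proof. by rewrite (ip_sym H) ipZl !(ip_sym H w). Qed.
Lemma ipNr u w : ip w (- u) = - ip w u.
Proof. by rewrite -scaleN1r ipZr mulN1r. Qed.
Lemma ip0r w : ip w 0 = 0.
Proof. by rewrite (ip_sym H) ip0l. Qed.
Definition ipE := (ipDl, ipDr, ipZl, ipZr, ipNl, ipNr, ip0l, ip0r).

Lemma ip_eq0 u : (ip u u == 0) = (u == 0).
Proof.
have [->|/(ip_pos H)] := eqVneq u 0; first by rewrite ip0l eqxx.
by rewrite lt_neqAle eq_sym => /andP[/negbTE->].
Qed.

Lemma JD u v : J (u + v) = J u + J v.
Proof. by rewrite -[u]scale1r (J_linear H) !scale1r. Qed.
Lemma J0 : J 0 = 0.
Proof. by apply: (addrI (J 0)); rewrite -JD !addr0. Qed.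
Lemma JZ k u : J (k *: u) = k *: J u.
Proof. by rewrite -[k *: u]addr0 (J_linear H) J0 addr0. Qed.
Lemma JN u : J (- u) = - J u.
Proof. by rewrite -scaleN1r JZ scaleN1r. Qed.
Definition JE := (JD, JZ, JN, JJ H).

Lemma ip_Jl u v : ip (J u) v = - ip u (J v).
Proof. by rewrite -(ip_JJ H u) (JJ H) ipNr opprK. Qed.

Lemma ip_Jself u : ip (J u) u = 0.
Proof. by have := ip_Jl u u; rewrite (ip_sym H u); lra. Qed.

Lemma ip_decomp e x : e != 0 ->
  exists k, exists y, x = k *: e + y /\ ip e y = 0.
Proof.
move=> e0; exists (ip e x / ip e e), (x - (ip e x / ip e e) *: e).
rewrite addrC subrK; split => //.
by rewrite !ipE mulfVK ?subrr // ip_eq0.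
Qed.

Section Symmetries.
Context {T : V -> V -> V -> V -> R} (HT : kahler_tensor J T).

Lemma T_pair a b c d : T a b c d = T c d a b.
Proof.
have B := T_bianchi HT; have s12 := T_anti12 HT; have s34 := T_anti34 HT.
have := B a b c d; have := B b c d a; have := B c d a b; have := B d a b c.
rewrite (s34 b c d a) (s34 c d b a) (s12 a c d b) (s34 c a d b) (s12 d a b c).
rewrite (s34 a d b c) (s12 a d c b) (s34 a b d c) (s12 b d a c) (s34 d b a c).
lra.
Qed.

Lemma T_J12 a b c d : T (J a) (J b) c d = T a b c d.
Proof. by rewrite T_pair (T_J34 HT) T_pair. Qed.

Lemma TD1 a a' b c d : T (a + a') b c d = T a b c d + T a' b c d.
Proof. by rewrite -[a]scale1r (T_linear HT) mul1r scale1r. Qed.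
Lemma T01 b c d : T 0 b c d = 0.
Proof. by apply: (addrI (T 0 b c d)); rewrite -TD1 !addr0. Qed.
Lemma TZ1 k a b c d : T (k *: a) b c d = k * T a b c d.
Proof. by rewrite -[k *: a]addr0 (T_linear HT) T01 addr0. Qed.
Lemma TN1 a b c d : T (- a) b c d = - T a b c d.
Proof. by rewrite -scaleN1r TZ1 mulN1r. Qed.

Lemma T_Jl a b c d : T (J a) b c d = - T a (J b) c d.
Proof. by rewrite -T_J12 (JJ H) TN1. Qed.

(** The polarized quartic form of the holomorphic sectional curvature, up to
    sign: Q(e,e,x,x) is a bisectional curvature. Unlike T itself, Q is symmetric
    in its first two and in its last two arguments, so that few of the terms of
    an expansion are distinct. *)
Definition bisec a b c d : R := T (J a) b (J c) d.
Local Notation Q := bisec.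
Local Notation F v := (bisec v v v v).

Lemma bisec_pair a b c d : Q a b c d = Q c d a b.
Proof. exact: T_pair. Qed.
Lemma bisecC12 a b c d : Q a b c d = Q b a c d.
Proof. by rewrite /bisec T_Jl (T_anti12 HT) opprK. Qed.
Lemma bisecC34 a b c d : Q a b c d = Q a b d c.
Proof. by rewrite bisec_pair bisecC12 bisec_pair. Qed.
Lemma bisecD1 a a' b c d : Q (a + a') b c d = Q a b c d + Q a' b c d.
Proof. by rewrite /bisec JD TD1. Qed.
Lemma bisecZ1 k a b c d : Q (k *: a) b c d = k * Q a b c d.
Proof. by rewrite /bisec JZ TZ1. Qed.
Lemma bisecD2 a a' b c d : Q b (a + a') c d = Q b a c d + Q b a' c d.
Proof. by rewrite !(bisecC12 b) bisecD1. Qed.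
Lemma bisecZ2 k a b c d : Q b (k *: a) c d = k * Q b a c d.
Proof. by rewrite !(bisecC12 b) bisecZ1. Qed.
Lemma bisecD3 a a' b c d : Q b c (a + a') d = Q b c a d + Q b c a' d.
Proof. by rewrite !(bisec_pair b) bisecD1. Qed.
Lemma bisecZ3 k a b c d : Q b c (k *: a) d = k * Q b c a d.
Proof. by rewrite !(bisec_pair b) bisecZ1. Qed.
Lemma bisecD4 a a' b c d : Q b c d (a + a') = Q b c d a + Q b c d a'.
Proof. by rewrite !(bisecC34 b c d) bisecD3. Qed.
Lemma bisecZ4 k a b c d : Q b c d (k *: a) = k * Q b c d a.
Proof. by rewrite !(bisecC34 b c d) bisecZ3. Qed.
Definition bisecE := (bisecD1, bisecD2, bisecD3, bisecD4,
  bisecZ1, bisecZ2, bisecZ3, bisecZ4).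

(** The Kähler form of the first Bianchi identity: together with [mixed] and
    [mixed_sum] it recovers the bisectional curvature from the quartic form. *)
Lemma bisec_bianchi e x : Q e e x x = Q e x e x + Q e (J x) e (J x).
Proof.
have := T_bianchi HT (J e) e (J x) x.
rewrite /bisec !T_J12 (T_J34 HT) (T_anti12 HT x e).
have := T_Jl e x (J e) x; lra.
Qed.

Lemma bisec_JJ e x : Q e e (J x) (J x) = Q e e x x.
Proof. by rewrite /bisec (T_J34 HT). Qed.

(** Half the coefficient of t^2 in F(e + t x). *)
Definition mixed e x : R := Q e e x x + 2 * Q e x e x.

(** The single expansion behind all rotation arguments: both F and its
    derivative, restricted to the real plane of e and x. *)
Lemma bisec_expand e x k l r s :
  let v := k *: e + l *: x in
  Q v v v (r *: e + s *: x) =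
  k ^+ 3 * r * F e + (k ^+ 3 * s + 3 * k ^+ 2 * l * r) * Q e e e x
  + (k ^+ 2 * l * s + k * l ^+ 2 * r) * mixed e x
  + (3 * k * l ^+ 2 * s + l ^+ 3 * r) * Q x x x e + l ^+ 3 * s * F x.
Proof.
rewrite /mixed !bisecE /=.
have e1 : Q e e x e = Q e e e x by rewrite bisecC34.
have e2 : Q e x e e = Q e e e x by rewrite bisec_pair.
have e3 : Q x e e e = Q e e e x by rewrite bisecC12.
have x1 : Q x x e x = Q x x x e by rewrite bisecC34.
have x2 : Q x e x x = Q x x x e by rewrite bisec_pair.
have x3 : Q e x x x = Q x x x e by rewrite bisecC12.
have m1 : Q x x e e = Q e e x x by rewrite bisec_pair.
have m2 : Q e x x e = Q e x e x by rewrite bisecC34.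
have m3 : Q x e e x = Q e x e x by rewrite bisecC12.
have m4 : Q x e x e = Q e x e x by rewrite bisecC12 bisecC34.
by rewrite e1 e2 e3 x1 x2 x3 m1 m2 m3 m4; ring.
Qed.

Lemma mixed_sum e x : mixed e x + mixed e (J x) = 4 * Q e e x x.
Proof. by rewrite /mixed bisec_JJ (bisec_bianchi e x); ring. Qed.

(** Q(v,v,v,.) is a quarter of the differential of F at v. It vanishes on Jv by
    antisymmetry and, by hypothesis, on the complement of v and Jv, so it is a
    multiple of <v,.>, and y = v gives the factor. *)
Lemma bisec_gradient :
  (forall v x, ip v x = 0 -> ip (J v) x = 0 -> Q v v v x = 0) ->
  forall v x, Q v v v x * ip v v = F v * ip v x.
Proof.
move=> hQ v x; have [->|v0] := eqVneq v 0.
  by rewrite !(ip0l, mulr0).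
have [k [y [-> vy]]] := ip_decomp x v0.
have Jv0 : J v != 0.
  by rewrite -ip_eq0 (ip_JJ H) ip_eq0.
have [l [z [yE Jvz]]] := ip_decomp y Jv0.
have vJv : ip v (J v) = 0 by rewrite (ip_sym H) ip_Jself.
have vz : ip v z = 0 by move: vy; rewrite yE !ipE vJv mulr0 add0r.
have QJ : Q v v v (J v) = 0.
  by have := T_anti34 HT (J v) v (J v) (J v); rewrite /bisec; lra.
by rewrite yE !bisecE QJ (hQ _ _ vz Jvz) !ipE vJv vz; ring.
Qed.

(** Along a line e + t y with y orthogonal to e, [bisec_gradient] is an identity
    between polynomials in t whose coefficients force
    F(e + t y) |e|^4 = F(e) |e + t y|^4. *)
Lemma bisec_constant :
  (forall v x, ip v x = 0 -> ip (J v) x = 0 -> Q v v v x = 0) ->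
  forall e x, F x * ip e e ^+ 2 = F e * ip x x ^+ 2.
Proof.
move=> /bisec_gradient G e x; have [->|e0] := eqVneq e 0.
  by rewrite /bisec J0 !T01 !ip0l; ring.
have [k [y [-> ey]]] := ip_decomp x e0.
have n0 : ip e e != 0 by rewrite ip_eq0.
have q3 : Q e e e y = 0.
  by apply: (mulIf n0); rewrite G ey mulr0 mul0r.
have q1 : Q y y y e = 0.
  have [y0|y0] := eqVneq y 0.
    by rewrite y0 /bisec J0 !T01.
  apply: (mulIf (_ : ip y y != 0)); first by rewrite ip_eq0.
  by rewrite G (ip_sym H) ey mulr0 mul0r.
have EF r s : F (r *: e + s *: y) =
   r ^+ 4 * F e + 2 * r ^+ 2 * s ^+ 2 * mixed e y + s ^+ 4 * F y.
  by rewrite bisec_expand q1 q3; ring.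
have EG s := G (1 *: e + s *: y) (0 *: e + 1 *: y).
have N r s : ip (r *: e + s *: y) (r *: e + s *: y) =
   r ^+ 2 * ip e e + s ^+ 2 * ip y y.
  by rewrite !ipE ey (ip_sym H y) ey; ring.
have {}EG s : (s * mixed e y + s ^+ 3 * F y) * (ip e e + s ^+ 2 * ip y y) =
   (F e + 2 * s ^+ 2 * mixed e y + s ^+ 4 * F y) * (s * ip y y).
  have := EG s; rewrite N EF bisec_expand q1 q3 !ipE ey (ip_sym H y) ey.
  by move=> E; apply: etrans (etrans E _); ring.
(* The values at t = 1 and t = 2 separate the coefficients of t and t^3. *)
have E1 : mixed e y * ip e e = F e * ip y y.
  by have := EG 1; have := EG 2%:R; lra.
have E2 : F y * ip e e = mixed e y * ip y y.
  by have := EG 1; have := EG 2%:R; lra.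
have -> : F (k *: e + y) = k ^+ 4 * F e + 2 * k ^+ 2 * mixed e y + F y.
  by rewrite -[y in LHS]scale1r EF; ring.
have -> : ip (k *: e + y) (k *: e + y) = k ^+ 2 * ip e e + ip y y.
  by rewrite -[y in LHS]scale1r N; ring.
have -> : (k ^+ 4 * F e + 2 * k ^+ 2 * mixed e y + F y) * ip e e ^+ 2 =
  k ^+ 4 * F e * ip e e ^+ 2 + 2 * k ^+ 2 * ip e e * (mixed e y * ip e e)
  + F y * ip e e * ip e e by ring.
rewrite E2 -(mulrAC (mixed e y)) E1; ring.
Qed.

Lemma TD2 b b' a c d : T a (b + b') c d = T a b c d + T a b' c d.
Proof. by rewrite !(T_anti12 HT a) TD1 opprD. Qed.
Lemma TD3 c c' a b d : T a b (c + c') d = T a b c d + T a b c' d.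
Proof. by rewrite !(T_pair a b) TD1. Qed.
Lemma TD4 d d' a b c : T a b c (d + d') = T a b c d + T a b c d'.
Proof. by rewrite !(T_pair a b) TD2. Qed.

(** If F vanishes then so does [mixed], for x and for Jx; adding the two gives
    Q(e,e,x,x) = 0 and hence Q(e,x,e,x) = 0. All sectional curvatures then
    vanish, and the usual polarization with the first Bianchi identity kills
    T. *)
Lemma bisec_eq0 : (forall v, F v = 0) -> forall a b c d, T a b c d = 0.
Proof.
move=> F0.
have M0 e x : mixed e x = 0.
  have := bisec_expand e x 1 1 1 1; have := bisec_expand e x 1 (-1) 1 (-1).
  by rewrite /= !F0; lra.
have S0 a b : T a b a b = 0.
  have := mixed_sum (- J a) b; rewrite !M0; have := M0 (- J a) b; rewrite /mixed.
  have -> : Q (- J a) b (- J a) b = T a b a b by rewrite /bisec !JE opprK.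
  by lra.
have S1 a b d : T a b a d = 0.
  by have := S0 a (b + d); rewrite TD2 !TD4 !S0 [T a d _ _]T_pair; lra.
move=> a b c d.
have S2 a' b' c' : T a' b' c' d = - T c' b' a' d.
  by have := S1 (a' + c') b' d; rewrite TD1 !TD3 !S1; lra.
have := T_bianchi HT a b c d.
by rewrite (T_anti12 HT b c) (T_anti12 HT c a) (S2 c b a) (S2 a c b)
  (T_anti12 HT b c) (S2 c b a); lra.
Qed.

Definition uorth u v : bool := (ip u v == 0) && (ip (J u) v == 0).

(** A unitary frame: unit vectors spanning pairwise orthogonal complex lines. *)
Definition frame (s : seq V) : bool :=
  all (fun u => ip u u == 1) s && pairwise uorth s.

Lemma uorth_sym : symmetric uorth.
Proof. by move=> u v; rewrite /uorth (ip_sym H u) ip_Jl (ip_sym H u) oppr_eq0. Qed.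

Lemma frame_cons u s :
  frame (u :: s) = [&& ip u u == 1, all (uorth u) s & frame s].
Proof. by rewrite /frame /=; case: (ip u u == 1); case: all; case: all. Qed.

(** Besides rotations this also provides the exchange of e and x up to a sign,
    with k = 0 and l = 1. *)
Lemma frame_rotate e x s k l : k ^+ 2 + l ^+ 2 = 1 -> frame [:: e, x & s] ->
  frame [:: k *: e + l *: x, - l *: e + k *: x & s].
Proof.
move=> kl; rewrite !frame_cons /=.
move=> /and5P[/eqP ee /andP[/andP[/eqP ex /eqP Jex] es] /eqP xx xs ->].
have Jxe : ip (J x) e = 0 by rewrite ip_Jl (ip_sym H) Jex oppr0.
rewrite {1}/uorth !ipE !JE !ipE ee xx ex (ip_sym H x) ex !ip_Jself Jex Jxe !andbT.
apply/and4P; split.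
- by apply/eqP; rewrite -[RHS]kl; ring.
- apply/andP; split; first by apply/andP; split; apply/eqP; ring.
  apply/allP => y ys; move: (allP es y ys) (allP xs y ys).
  rewrite /uorth !JE !ipE => /andP[/eqP-> /eqP->] /andP[/eqP-> /eqP->].
  by rewrite !mulr0 addr0 eqxx.
- by apply/eqP; rewrite -[RHS]kl; ring.
- apply/allP => y ys; move: (allP es y ys) (allP xs y ys).
  rewrite /uorth !JE !ipE => /andP[/eqP-> /eqP->] /andP[/eqP-> /eqP->].
  by rewrite !mulr0 addr0 eqxx.
Qed.

Lemma frame_J e x s : frame [:: e, x & s] -> frame [:: e, J x & s].
Proof.
rewrite !frame_cons /= => /and5P[-> /andP[/andP[ex Jex] ->] xx xs ->].
rewrite (ip_JJ H) xx !andbT /=; apply/andP; split.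
  by rewrite /uorth (ip_JJ H) ex andbT -[ip _ _]opprK -ip_Jl oppr_eq0.
apply/allP => y ys; move: (allP xs y ys).
by rewrite /uorth (JJ H) ipNl oppr_eq0 andbC.
Qed.

(** The identity that special submanifolds produce on unitary frames of size
    N + 2 is turned here into the vanishing of Q(e,e,e,x). *)
Section FrameIdentity.
Context (al : R) (N : nat) (al_gt0 : 0 < al).
Context (extend : forall e x, frame [:: e; x] ->
  exists2 ys, size ys = N & frame [:: e, x & ys]).
Context (identity : forall e x ys, size ys = N -> frame [:: e, x & ys] ->
  al * Q e e e x + \sum_(y <- ys) Q y y e x = 0).

Let half_sqrt : exists c : R, c ^+ 2 + c ^+ 2 = 1.
Proof.
exists (Num.sqrt 2^-1); rewrite sqr_sqrtr; first by field.
by rewrite invr_ge0 ler0n.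
Qed.

(** The sum over the y_j is symmetric in e and x, so exchanging e and x in the
    identity leaves only the first terms. *)
Lemma frame_q3 e x : frame [:: e; x] -> Q e e e x = Q x x x e.
Proof.
move=> ex; have [ys ysN exys] := extend ex.
have := identity ysN exys.
have fr : frame [:: x, - e & ys].
  have := frame_rotate (k := 0) (l := 1) _ exys.
  by rewrite expr0n expr1n add0r !scale0r scaleN1r scale1r add0r addr0; apply.
have := identity ysN fr.
under eq_bigr do rewrite -scaleN1r bisecZ4 mulN1r bisecC34.
rewrite sumrN -scaleN1r bisecZ4 => E1 E2.
have : al * (Q e e e x - Q x x x e) = 0 by lra.
by move=> /eqP; rewrite mulf_eq0 gt_eqF //= subr_eq0 => /eqP.
Qed.

Lemma frame_rotate2 e x k l : k ^+ 2 + l ^+ 2 = 1 -> frame [:: e; x] ->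
  frame [:: k *: e + l *: x; - l *: e + k *: x].
Proof. exact: frame_rotate. Qed.

(** On the circle of the real plane of e and x, [frame_q3] says that F and its
    rotation by 90 degrees have a constant sum; a rotation by any angle that is
    not a multiple of 45 degrees extracts the coefficient. *)
Lemma frame_mixed e x : frame [:: e; x] -> 2 * mixed e x = F e + F x.
Proof.
move=> ex; have q31 := frame_q3 ex.
(* The rational point (3/5, 4/5) of the unit circle avoids square roots. *)
have kl : (3 / 5 : R) ^+ 2 + (4 / 5) ^+ 2 = 1 by field.
have := frame_q3 (frame_rotate2 kl ex).
rewrite !bisec_expand q31; lra.
Qed.

(** [frame_mixed] holds for x and for Jx, and the sum of the two mixed
    coefficients is a bisectional curvature. *)
Lemma frame_bisec e x : frame [:: e; x] -> 4 * Q e e x x = F e + F x.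
Proof.
move=> ex; have := frame_mixed ex; have := frame_mixed (frame_J ex).
have := mixed_sum e x.
have -> : F (J x) = F x by rewrite /bisec T_J12 (T_J34 HT).
lra.
Qed.

(** A rotation by 45 degrees turns Q(e,e,e,x) into (F(x) - F(e)) / 4 and, by
    [frame_bisec], each Q(y,y,e,x) into (F(x) - F(e)) / 8. All these
    contributions have the same sign. *)
Lemma frame_F e x : frame [:: e; x] -> F e = F x.
Proof.
move=> ex; have q31 := frame_q3 ex; have [ys ysN exys] := extend ex.
have [c c2] := half_sqrt.
have c4 : c ^+ 4 = 4^-1.
  have -> : c ^+ 4 = (c ^+ 2) * (c ^+ 2) by ring.
  have -> : c ^+ 2 = 2^-1 by lra.
  by field.
have := identity ysN (frame_rotate c2 exys).
have sE : \sum_(y <- ys) Q y y (c *: e + c *: x) (- c *: e + c *: x) =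
   N%:R * (8^-1 * (F x - F e)).
  rewrite -ysN -sum1_size natr_sum mulr_suml; apply: eq_big_seq => y yys.
  have ye : frame [:: y; e].
    move: exys; rewrite !frame_cons /= => /and5P[-> /andP[_ ae] _ _].
    move=> /andP[/allP/(_ y yys)-> _]; rewrite uorth_sym.
    by rewrite (allP ae _ yys).
  have yx : frame [:: y; x].
    move: exys; rewrite !frame_cons /= => /and5P[_ _ -> ax].
    move=> /andP[/allP/(_ y yys)-> _]; rewrite uorth_sym.
    by rewrite (allP ax _ yys).
  have := frame_bisec ye; have := frame_bisec yx.
  have c2' : c ^+ 2 = 2^-1 by lra.
  have -> : Q y y (c *: e + c *: x) (- c *: e + c *: x) =
    c ^+ 2 * (Q y y x x - Q y y e e).
    by rewrite !bisecE (bisecC34 y y x e); ring.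
  by rewrite c2'; lra.
rewrite sE bisec_expand q31.
set M := mixed e x; set q := Q x x x e => E.
have {}E : (al + N%:R / 2) * (F x - F e) = 0.
  have : al * c ^+ 4 * (F x - F e) + N%:R * (8^-1 * (F x - F e)) = 0.
    by rewrite -[RHS]E; ring.
  by rewrite c4; lra.
have NN : 0 <= N%:R :> R by rewrite ler0n.
move/eqP: E; rewrite mulf_eq0 gt_eqF /=; first by rewrite subr_eq0 => /eqP.
by apply: ltr_wpDr => //; rewrite divr_ge0 // ler0n.
Qed.

(** The difference F((e+x)/sqrt 2) - F((x-e)/sqrt 2), which vanishes by
    [frame_F], is 2 (Q(e,e,e,x) + Q(x,x,x,e)), and the two terms are equal. *)
Lemma frame_q3_eq0 e x : frame [:: e; x] -> Q e e e x = 0.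
Proof.
move=> ex; have q31 := frame_q3 ex; have [c c2] := half_sqrt.
have c4 : c ^+ 4 = 4^-1.
  have -> : c ^+ 4 = (c ^+ 2) * (c ^+ 2) by ring.
  have -> : c ^+ 2 = 2^-1 by lra.
  by field.
have := frame_F (frame_rotate2 c2 ex).
rewrite !bisec_expand q31 => E.
have : c ^+ 4 * (16%:R * Q x x x e) = 0 by move: E; lra.
by rewrite c4; lra.
Qed.

Lemma frame_bisec_constant e x : F x * ip e e ^+ 2 = F e * ip x x ^+ 2.
Proof.
apply: bisec_constant => {e x} v x vx Jvx.
have [->|v0] := eqVneq v 0; first by rewrite /bisec J0 !T01.
have [->|x0] := eqVneq x 0; first by rewrite -(scale0r 0) bisecZ4 mul0r.
have nrm w : w != 0 -> exists2 k : R, k != 0 & ip (k *: w) (k *: w) = 1.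
  move=> /(ip_pos H) w0; exists (Num.sqrt (ip w w))^-1.
    by rewrite invr_eq0 sqrtr_eq0 -ltNge.
  by rewrite !ipE mulrA -expr2 exprVn sqr_sqrtr ?mulVf ?ltW // gt_eqF.
have [k k0 kv] := nrm _ v0; have [l l0 lx] := nrm _ x0.
have : Q (k *: v) (k *: v) (k *: v) (l *: x) = 0.
  apply: frame_q3_eq0.
  by rewrite !frame_cons /= kv lx /uorth JE !ipE vx Jvx !mulr0 !eqxx.
rewrite !bisecE => /eqP; rewrite !mulf_eq0 (negbTE k0) (negbTE l0) /=.
by move/eqP.
Qed.

End FrameIdentity.
End Symmetries.
End Tensor.

Arguments bisec {R V} J T a b c d.
Arguments uorth {R V} ip J u v.
Arguments frame {R V} ip J s.

(** * The curvature tensor of constant holomorphic curvature *)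

Section Model.
Context {R : rcfType} {V : lmodType R} (ip : V -> V -> R) (J : V -> V).
Implicit Types (a b c d e u v w x y z : V) (k : R).

(** The curvature tensor R(a,b)c of a complex space form of holomorphic
    sectional curvature 4. *)
Definition model_curv a b c : V :=
  ip b c *: a - ip a c *: b + ip (J b) c *: J a - ip (J a) c *: J b
  - (2 * ip (J a) b) *: J c.

Context (H : hermitian_space ip J).

Lemma model_curvE a b c d : ip (model_curv a b c) d =
  ip b c * ip a d - ip a c * ip b d + ip (J b) c * ip (J a) d
  - ip (J a) c * ip (J b) d - 2 * ip (J a) b * ip (J c) d.
Proof. by rewrite /model_curv !(ipE H). Qed.

Lemma model_curv_kahler : kahler_tensor J (fun a b c d => ip (model_curv a b c) d).
Proof.
have s := ip_sym H; have Js a b : ip (J a) b = - ip (J b) a.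
  by rewrite (ip_Jl H) s.
split => [k a a' b c d|a b c d|a b c d|a b c d|a b c d]; rewrite !model_curvE.
- by rewrite !(JE H) !(ipE H); ring.
- by rewrite (Js b a); ring.
- rewrite (s a d) (s b d) (Js d c) (Js a d) (Js b d) (Js d a) (Js d b).
  by rewrite (Js a c) (Js b c) (s a c) (s b c) (Js c d); ring.
- rewrite (s b a) (s c a) (s c b) (Js b a) (Js c a) (Js c b); ring.
- have e x y : ip x (J y) = - ip (J x) y by rewrite (ip_Jl H) opprK.
  by rewrite !(ip_JJ H) !e; ring.
Qed.

(** The difference of T and k times the model has the same symmetries and zero
    quartic form. *)
Lemma model_curv_unique (T : V -> V -> V -> V -> R) k : kahler_tensor J T ->
  (forall v, T v (J v) (J v) v = 4 * k * ip v v ^+ 2) ->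
  forall a b c d, T a b c d = k * ip (model_curv a b c) d.
Proof.
move=> HT Tk a b c d.
pose T0 a b c d := ip (model_curv a b c) d; have H0 : kahler_tensor J T0 := model_curv_kahler.
pose D a b c d := T a b c d - k * T0 a b c d.
have HD : kahler_tensor J D.
  split=> [l u u' v w z|u v w z|u v w z|u v w z|u v w z]; rewrite /D.
  - by rewrite (T_linear HT) (T_linear H0); ring.
  - by rewrite (T_anti12 HT) (T_anti12 H0); ring.
  - by rewrite (T_anti34 HT) (T_anti34 H0); ring.
  - have -> : forall t1 t2 t3 s1 s2 s3 : R,
      t1 - k * s1 + (t2 - k * s2) + (t3 - k * s3) =
      (t1 + t2 + t3) - k * (s1 + s2 + s3) by move=> *; ring.
    by rewrite (T_bianchi HT) (T_bianchi H0) mulr0 subr0.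
  - by rewrite (T_J34 HT) (T_J34 H0).
have F0 v : bisec J D v v v v = 0.
  rewrite /bisec (T_anti12 HD) /D Tk /T0 model_curvE (ip_JJ H) !(JJ H) !(ipE H).
  by rewrite (ip_sym H v) !(ip_Jself H); ring.
by have /eqP := bisec_eq0 H HD F0 a b c d; rewrite /D subr_eq0 => /eqP.
Qed.

Lemma ip_inj x y : (forall d, ip x d = ip y d) -> x = y.
Proof.
move=> xy; apply/eqP; rewrite -subr_eq0 -(ip_eq0 H) (ipDl H) (ipNl H) xy.
by rewrite subrr.
Qed.

End Model.

(** * From conditions on subspaces to constant holomorphic curvature *)

Section Sums.
Context {R : rcfType} {V : lmodType R} {ip : V -> V -> R} {J : V -> V}.
Context (H : hermitian_space ip J).
Context {T : V -> V -> V -> V -> R} (HT : kahler_tensor J T).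
Implicit Types (e w x y z : V) (s ys : seq V).

Local Notation Q := (bisec J T).
Local Notation F v := (bisec J T v v v v).
Local Notation frame := (frame ip J).

(** The Bianchi identity collapses the contribution of a complex line to the sum
    over an orthonormal basis into a term that is symmetric in w and z. *)
Lemma bisec_split y w z : T y w y z + T (J y) w (J y) z = Q y y w z.
Proof.
have := T_bianchi HT (J y) y (J w) z.
rewrite (T_J12 HT) (T_anti12 HT w y) /bisec.
by have := T_Jl H HT y w (J y) z; lra.
Qed.

Lemma frame_map_J e x ys : frame [:: e, x & ys] -> frame [:: e, x & map J ys].
Proof.
have uJ u v : uorth ip J u v -> uorth ip J u (J v).
  rewrite /uorth (ip_JJ H) => /andP[uv Juv]; rewrite uv andbT.
  by rewrite -oppr_eq0 -(ip_Jl H).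
have aJ u : all (uorth ip J u) ys -> all (uorth ip J u) (map J ys).
  by rewrite all_map; apply: sub_all => v; exact: uJ.
rewrite !frame_cons /= => /and5P[-> /andP[-> /aJ->] -> /aJ-> /=].
rewrite /frame all_map pairwise_map => /andP[a p]; apply/andP; split.
  by apply: sub_all a => v /=; rewrite (ip_JJ H).
by apply: sub_pairwise p => u v /=; rewrite /uorth !(ip_JJ H).
Qed.

Context (N : nat).
Context (extend : forall e x, frame [:: e; x] ->
  exists2 ys, size ys = N & frame [:: e, x & ys]).

(** W is the complex span of e, y_1, ..., y_N, with w = e and z = x. *)
Lemma bisec_constant_of_holomorphic :
  (forall s w z, size s = N.+1 -> frame s -> w \in s ->
     (forall y, y \in s -> ip y z = 0 /\ ip (J y) z = 0) ->
     \sum_(y <- s) (T y w y z + T (J y) w (J y) z) = 0) ->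
  forall e x, F x * ip e e ^+ 2 = F e * ip x x ^+ 2.
Proof.
move=> hs; apply: (frame_bisec_constant H HT ltr01 extend) => e x ys ysN exys.
have := hs (e :: ys) e x; rewrite /= ysN inE eqxx big_cons => hs'.
rewrite mul1r -bisec_split; under eq_bigr do rewrite -bisec_split.
move: exys; rewrite !frame_cons /=.
move=> /and5P[ee /andP[ex eys] _ xys fys]; apply: hs' => //.
  by rewrite frame_cons ee eys fys.
move=> y; rewrite inE => /orP[/eqP->|/(allP xys)].
  by case/andP: ex => /eqP-> /eqP->.
by rewrite (uorth_sym H) => /andP[/eqP-> /eqP->].
Qed.

(** W is the real span of e, Jx, y_1, ..., y_N, with w = Jx and z = Je. The sum
    then starts with Q(e,e,e,x); replacing every y_j by J y_j and adding pairs
    the remaining terms as in [bisec_split]. *)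
Lemma bisec_constant_of_antiholomorphic :
  (forall s w z, size s = N.+2 -> frame s -> w \in s ->
     (forall y, y \in s -> ip y z = 0) -> \sum_(y <- s) T y w y z = 0) ->
  forall e x, F x * ip e e ^+ 2 = F e * ip x x ^+ 2.
Proof.
move=> hs; apply: (frame_bisec_constant H HT (ltr0n _ 2) extend) => e x ys ysN.
move=> exys.
have key zs : size zs = N -> frame [:: e, x & zs] ->
    Q e e e x + \sum_(y <- zs) T y (J x) y (J e) = 0.
  move=> zsN exzs; have eJxzs := frame_J H exzs.
  have := hs [:: e, J x & zs] (J x) (J e).
  rewrite /= zsN !inE eqxx orbT !big_cons => /(_ erefl eJxzs isT).
  have -> : T (J x) (J x) (J x) (J e) = 0.
    by have := T_anti12 HT (J x) (J x) (J x) (J e); lra.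
  have -> : T e (J x) e (J e) = Q e e e x.
    have := T_Jl H HT e e e (J x); have := T_Jl H HT e x (J e) e.
    rewrite (T_pair HT e (J x) e) (T_pair HT e (J x) (J e)).
    by rewrite (T_pair HT (J e) x) /bisec; lra.
  rewrite add0r; apply=> y; move: exzs; rewrite !frame_cons /=.
  move=> /and5P[_ /andP[/andP[ex _] ezs] _ _ _].
  rewrite !inE => /or3P[/eqP->|/eqP->|/(allP ezs)].
  - by rewrite (ip_sym H) (ip_Jself H).
  - by rewrite (ip_JJ H) (ip_sym H); apply/eqP.
  - by move=> /andP[_ /eqP]; rewrite (ip_sym H).
have := key _ ysN exys.
have := key (map J ys) (etrans (size_map _ _) ysN) (frame_map_J exys).
rewrite big_map => E1 E2.
have -> : \sum_(y <- ys) Q y y e x = \sum_(y <- ys) T y (J x) y (J e)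
    + \sum_(y <- ys) T (J y) (J x) (J y) (J e).
  rewrite -big_split; apply: eq_bigr => y _ /=.
  by rewrite bisec_split (bisecC34 H HT) /bisec (T_J34 HT).
lra.
Qed.

End Sums.

(** * Symmetry of second derivatives and matrix calculus *)

Section Schwarz.
Context {R : realType} {V : normedModType R}.
Implicit Types (f : V -> R) (x u v p : V) (U : set V).

Lemma is_derive_line f p v (t : R) : derivable f (p + t *: v) v ->
  is_derive t 1 (fun h : R => f (p + h *: v)) ('D_v f (p + t *: v)).
Proof.
move=> df.
have E : (fun h : R => h^-1 *: (((fun h : R => f (p + h *: v)) \o shift t)
    (h *: (1 : R)) - f (p + t *: v))) =
  (fun h : R => h^-1 *: ((f \o shift (p + t *: v)) (h *: v) - f (p + t *: v))).
  apply/funext => h /=; congr (_ *: (f _ - _)).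
  by rewrite [h%:A]mulr1 scalerDl addrCA.
by split; rewrite /derivable /derive E.
Qed.

Lemma mvt_line f p v (s : R) : 0 < s ->
  (forall t, 0 <= t <= s -> derivable f (p + t *: v) v) ->
  exists2 t, 0 <= t <= s & f (p + s *: v) - f p = s * 'D_v f (p + t *: v).
Proof.
move=> s0 df.
have dF t : 0 <= t <= s ->
    is_derive t 1 (fun h : R => f (p + h *: v)) ('D_v f (p + t *: v)).
  by move=> /df; exact: is_derive_line.
have [||t] := @MVT R (fun h : R => f (p + h *: v))
  (fun h => 'D_v f (p + h *: v)) 0 s s0.
- by move=> t; rewrite in_itv /= => /andP[/ltW t0 /ltW ts]; apply: dF; rewrite t0.
- apply: derivable_within_continuous => t; rewrite in_itv /= => ts.
  by have [] := dF t ts.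
rewrite in_itv /= => /andP[/ltW t0 /ltW ts]; rewrite scale0r addr0 subr0 mulrC.
by move=> E; exists t; rewrite ?t0.
Qed.

(** The second difference of f over a small square equals s^2 times a mixed
    second derivative at some point of the square. *)
Lemma mvt_square f p u v (s : R) : 0 < s ->
  (forall a b : R, 0 <= a <= s -> 0 <= b <= s ->
     derivable f (p + a *: u + b *: v) u /\
     derivable ('D_u f) (p + a *: u + b *: v) v) ->
  exists a b, [/\ 0 <= a <= s, 0 <= b <= s &
    f (p + s *: u + s *: v) - f (p + s *: u) - f (p + s *: v) + f p =
    s * (s * 'D_v ('D_u f) (p + a *: u + b *: v))].
Proof.
move=> s0 df; have ss : 0 <= s <= s by rewrite lexx ltW.
have s00 : 0 <= (0 : R) <= s by rewrite lexx ltW.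
pose g1 x := f (x + s *: v).
pose g := g1 - f; have gx y : g y = f (y + s *: v) - f y by [].
have gE a : 0 <= a <= s -> is_derive (p + a *: u) u g
    ('D_u f (p + a *: u + s *: v) - 'D_u f (p + a *: u)).
  move=> aS.
  have d1 : is_derive (p + a *: u) u g1 ('D_u f (p + a *: u + s *: v)).
    have /derivableP d1 := (df a s aS ss).1.
    have sh : g1 \o shift (p + a *: u) =
       f \o shift (p + a *: u + s *: v).
      by apply/funext => h /=; rewrite /g1 /= -addrA.
    by have [d2 d3] := d1; split; rewrite /derivable /derive sh.
  apply: is_deriveB.
  by apply: derivableP; have := (df a 0 aS s00).1; rewrite scale0r addr0.
have [|a aS Ea] := @mvt_line g p u s s0.
  by move=> a /gE[].
have [_ Da] := gE a aS.
have [|b bS Eb] := @mvt_line ('D_u f) (p + a *: u) v s s0.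
  by move=> b bS; have [] := df a b aS bS.
exists a, b; split => //; rewrite -Eb -Da -Ea !gx; ring.
Qed.

(** The second difference is symmetric in u and v, so both mixed derivatives
    take a common value arbitrarily close to x; continuity does the rest. *)
Lemma schwarz f U x u v : open U -> U x ->
  (forall y, U y -> forall w, derivable f y w) ->
  (forall y, U y -> forall w w', derivable ('D_w f) y w') ->
  {for x, continuous ('D_u ('D_v f))} -> {for x, continuous ('D_v ('D_u f))} ->
  'D_u ('D_v f) x = 'D_v ('D_u f) x.
Proof.
move=> oU Ux d1 d2 c1 c2; apply/eqP; rewrite -subr_eq0 -normr_le0.
apply/ler_addgt0Pl => e e0; rewrite addr0.
have e2 : 0 < e / 2 by rewrite divr_gt0.
have /nbhs_ballP[r /= r0 rP] : nbhs x [set y | [/\ U y,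
    `|'D_u ('D_v f) x - 'D_u ('D_v f) y| < e / 2 &
    `|'D_v ('D_u f) x - 'D_v ('D_u f) y| < e / 2]].
  have n1 : nbhs x U by exact: open_nbhs_nbhs.
  move/cvgrPdist_lt : (c1) => /(_ _ e2) n2.
  move/cvgrPdist_lt : (c2) => /(_ _ e2) n3.
  have n23 := @filterI _ _ (nbhs_filter x) _ _ n2 n3.
  have n123 := @filterI _ _ (nbhs_filter x) _ _ n1 n23.
  apply: (@filterS _ _ (nbhs_filter x) _ _ _ n123).
  by move=> y [h1 [h2 h3]]; exact: And3 h1 h2 h3.
(* The side is chosen so that the whole square lies in the ball. *)
pose s := r / (2 * (`|u| + `|v| + 1)).
have K0 : 0 < `|u| + `|v| + 1 by rewrite ltr_wpDl // addr_ge0.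
have s0 : 0 < s by rewrite divr_gt0 // mulr_gt0.
have box a b : 0 <= a <= s -> 0 <= b <= s -> ball x r (x + a *: u + b *: v).
  move=> /andP[a0 aS] /andP[b0 bS]; rewrite -ball_normE /ball_ /=.
  rewrite -addrA opprD addNKr normrN.
  apply: (@le_lt_trans _ _ (s * (`|u| + `|v| + 1))); last first.
    rewrite /s invfM mulrA mulfVK ?gt_eqF // ltr_pdivrMr // ltr_pMr //.
    by rewrite ltr1n.
  apply: le_trans (ler_normD _ _) _; rewrite !normrZ !ger0_norm //.
  rewrite !mulrDr mulr1 -[leLHS]addr0 lerD ?(ltW s0) // lerD //.
    exact: ler_wpM2r.
  exact: ler_wpM2r.
have box' a b : 0 <= a <= s -> 0 <= b <= s -> ball x r (x + a *: v + b *: u).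
  by move=> aS bS; rewrite addrAC; exact: box.
have [|a [b [aS bS E1]]] := @mvt_square f x u v s s0.
  by move=> a b aS bS; have [Uy _ _] := rP _ (box a b aS bS); split;
    [exact: d1|exact: d2].
have [|a' [b' [a'S b'S E2]]] := @mvt_square f x v u s s0.
  by move=> a' b' aS' bS'; have [Uy _ _] := rP _ (box' _ _ aS' bS'); split;
    [exact: d1|exact: d2].
have sn0 : s != 0 by rewrite gt_eqF.
have E : 'D_v ('D_u f) (x + a *: u + b *: v) =
    'D_u ('D_v f) (x + a' *: v + b' *: u).
  apply: (mulfI sn0); apply: (mulfI sn0).
  apply: etrans (esym E1) (etrans _ E2); rewrite (addrAC x (s *: u)).
  move: (f (x + s *: v + s *: u)) (f (x + s *: u)) (f (x + s *: v)) (f x).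
  by move=> f1 f2 f3 f4; ring.
have [_ _ n1] := rP _ (box a b aS bS).
have [_ n2 _] := rP _ (box' a' b' a'S b'S).
rewrite -[X in X - _](subrK ('D_u ('D_v f) (x + a' *: v + b' *: u))) -addrA.
apply: le_trans (ler_normD _ _) _; rewrite [leRHS](splitr e).
apply: lerD; first exact: ltW n2.
by rewrite -E distrC; exact: ltW n1.
Qed.

End Schwarz.

Section MatrixCalculus.
Context {R : realType} {V : normedModType R}.
Implicit Types (x u v : V).

Lemma is_derive_mxP p q (f : V -> 'M[R]_(p, q)) x v df :
  is_derive x v f df <->
  forall i j, is_derive x v (fun y => f y i j) (df i j).
Proof.
split=> [[d <-] i j|fij].
  split; first exact: (derivable_mxP _ _ _).1 d i j.
  by rewrite (derive_mx d) mxE.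
have d : derivable f x v by apply/derivable_mxP => i j; have [] := fij i j.
split=> //; rewrite (derive_mx d); apply/matrixP => i j; rewrite mxE.
by have [_ ->] := fij i j.
Qed.

Lemma is_derive_mulmx p q r (f : V -> 'M[R]_(p, q)) (g : V -> 'M[R]_(q, r))
    x v df dg : is_derive x v f df -> is_derive x v g dg ->
  is_derive x v (fun y => f y *m g y) (df *m g x + f x *m dg).
Proof.
move=> /is_derive_mxP hf /is_derive_mxP hg; apply/is_derive_mxP => i j.
have -> : (fun y => (f y *m g y) i j) =
    \sum_k ((fun y => f y i k) * (fun y => g y k j)).
  by apply/funext => y; rewrite fct_sumE mxE.
have -> : (df *m g x + f x *m dg) i j =
    \sum_k (f x i k *: dg k j + g x k j *: df i k).
  rewrite !mxE -big_split; apply: eq_bigr => k _ /=; rewrite addrC.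
  by congr (_ + _); exact: mulrC.
by apply: is_derive_sum => k; apply: is_deriveM.
Qed.

Lemma is_derive_trmx p q (f : V -> 'M[R]_(p, q)) x v df :
  is_derive x v f df -> is_derive x v (fun y => (f y)^T) df^T.
Proof.
move=> /is_derive_mxP hf; apply/is_derive_mxP => i j.
by rewrite mxE (_ : (fun y => _) = (fun y => f y j i)) //;
  apply/funext => y; rewrite mxE.
Qed.

Lemma is_derive_eq_near (W : normedModType R) (U : set V) (f g : V -> W)
    x v df :
  open U -> U x -> (forall y, U y -> f y = g y) -> is_derive x v f df ->
  is_derive x v g df.
Proof.
move=> oU Ux fg; apply: near_eq_is_derive.
by apply: (filterS _ (open_nbhs_nbhs (conj oU Ux))) => y; exact: fg.
Qed.

Lemma is_derive_comp (W W' : normedModType R) (f : V -> W) (g : W -> W') x v :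
  differentiable f x -> differentiable g (f x) ->
  is_derive x v (fun y => g (f y)) ('D_('D_v f x) g (f x)).
Proof.
move=> df dg; have dgf := differentiable_comp df dg.
have E := diff_comp df dg.
rewrite -[fun _ => _]/(g \o f); split; first exact: diff_derivable.
by rewrite deriveE // E /= !deriveE.
Qed.

Lemma deriveD_dir (W : normedModType R) (f : V -> W) x k u v :
  differentiable f x -> 'D_(k *: u + v) f x = k *: 'D_u f x + 'D_v f x.
Proof. by move=> df; rewrite !deriveE // linearP. Qed.

(** Entrywise [schwarz]. The entries of a derivative are only known to be the
    derivatives of the entries where the function is derivable, so the second
    derivatives have to be compared on the open set U. *)
Lemma schwarz_mx p q (f : V -> 'M[R]_(p, q)) (U : set V) x u v :
  open U -> U x ->
  (forall y, U y -> forall w, derivable f y w) ->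
  (forall y, U y -> forall w w', derivable ('D_w f) y w') ->
  {for x, continuous ('D_u ('D_v f))} -> {for x, continuous ('D_v ('D_u f))} ->
  'D_u ('D_v f) x = 'D_v ('D_u f) x.
Proof.
move=> oU Ux d1 d2 c1 c2; apply/matrixP => i j.
have e1 y w : U y -> 'D_w (fun z => f z i j) y = 'D_w f y i j.
  by move=> Uy; rewrite (derive_mx (d1 y Uy w)) mxE.
have h1 y w w' : U y ->
    is_derive y w' ('D_w (fun z => f z i j)) ('D_w' ('D_w f) y i j).
  move=> Uy; apply: (@is_derive_eq_near _ U (fun z => 'D_w f z i j)) => //.
    by move=> z Uz; rewrite e1.
  have := derivableP (d2 y Uy w w').
  by move=> /is_derive_mxP/(_ i j).
have e2 y w w' : U y ->
    'D_w' ('D_w (fun z => f z i j)) y = 'D_w' ('D_w f) y i j.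
  by move=> /(h1 y w w')[].
have cont w w' : {for x, continuous ('D_w' ('D_w f))} ->
    {for x, continuous ('D_w' ('D_w (fun z => f z i j)))}.
  move=> c; have c' : {for x, continuous (fun z => 'D_w' ('D_w f) z i j)}.
    exact: (continuous_comp c (@coord_continuous _ _ _ i j _)).
  apply: (cvg_trans _ (_ : (fun z => 'D_w' ('D_w f) z i j) @ x --> _)).
    apply: near_eq_cvg; apply: (filterS _ (open_nbhs_nbhs (conj oU Ux))).
    by move=> y Uy; rewrite e2.
  by rewrite e2.
apply: etrans (esym (e2 x v u Ux)) (etrans _ (e2 x u v Ux)).
apply: (schwarz oU Ux).
- by move=> y Uy w; exact: (derivable_mxP _ _ _).1 (d1 y Uy w) i j.
- by move=> y Uy w w'; have [] := h1 y w w' Uy.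
- exact: cont.
- exact: cont.
Qed.

(** Balls are convex: apply the mean value theorem on the segment from x. *)
Lemma derive0_ball_constant (f : V -> R) x r :
  (forall y u, ball x r y -> is_derive y u f 0) ->
  forall y, ball x r y -> f y = f x.
Proof.
move=> df y xy.
have seg t : 0 <= t <= 1 -> ball x r (x + t *: (y - x)).
  move=> /andP[t0 t1]; move: xy; rewrite -!ball_normE /ball_ /=.
  rewrite opprD addNKr normrN normrZ ger0_norm // distrC => xy.
  by apply: le_lt_trans xy; rewrite -[leRHS]mul1r ler_wpM2r.
have [|t tS] := @mvt_line _ _ f x (y - x) 1 ltr01.
  by move=> t /seg /(df _ (y - x))[].
have [_ ->] := df _ (y - x) (seg t tS).
by rewrite mulr0 scale1r [x + _]addrC subrK => /eqP; rewrite subr_eq0 => /eqP.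
Qed.

End MatrixCalculus.

Section Smooth.
Context {R : realType} {n : nat}.
Implicit Types (U : set 'rV[R]_n).

Lemma smooth_cst (W : normedModType R) U (c : W) : smooth U (cst c).
Proof.
move=> k; elim: k c => [|k IH] c /=; first by move=> x _; exact: cst_continuous.
split=> [x _|v]; first exact: differentiable_cst.
by rewrite (_ : 'D_v _ = cst 0) //; apply/funext => x; rewrite derive_cst.
Qed.

Lemma smooth_differentiable (W : normedModType R) U (f : 'rV[R]_n -> W) x :
  smooth U f -> U x -> differentiable f x.
Proof. by move=> /(_ 1%N)[d _]; exact: d. Qed.

Lemma smooth_derive (W : normedModType R) U (f : 'rV[R]_n -> W) v :
  smooth U f -> smooth U ('D_v f).
Proof. by move=> sf k; have [_] := sf k.+1; exact. Qed.

Lemma smooth_is_derive (W : normedModType R) U (f : 'rV[R]_n -> W) x v :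
  smooth U f -> U x -> is_derive x v f ('D_v f x).
Proof.
by move=> sf Ux; apply/derivableP/diff_derivable/(smooth_differentiable sf).
Qed.

Lemma smooth_schwarz p q U (f : 'rV[R]_n -> 'M[R]_(p, q)) x u v :
  open U -> smooth U f -> U x -> 'D_u ('D_v f) x = 'D_v ('D_u f) x.
Proof.
move=> oU sf Ux; apply: (schwarz_mx oU Ux).
- by move=> y Uy w; have [] := smooth_is_derive w sf Uy.
- by move=> y Uy w w'; have [] := smooth_is_derive w' (smooth_derive w sf) Uy.
- exact: (smooth_derive u (smooth_derive v sf) 0%N).
- exact: (smooth_derive v (smooth_derive u sf) 0%N).
Qed.

End Smooth.

(** * Christoffel symbols as matrices *)

Section MatrixEntries.
Context {R : comPzRingType} {p q : nat}.
Implicit Types A B : 'M[R]_(p, q).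

Lemma mxD A B i j : (A + B) i j = A i j + B i j.
Proof. by rewrite mxE. Qed.
Lemma mxN A i j : (- A) i j = - A i j.
Proof. by rewrite mxE. Qed.

Lemma mxZ k A i j : (k *: A) i j = k * A i j.
Proof. by rewrite mxE. Qed.

Lemma trmxD A B : (A + B)^T = A^T + B^T.
Proof. exact: linearD. Qed.
Lemma trmxN A : (- A)^T = - A^T.
Proof. exact: linearN. Qed.

Lemma row_mulmx_inj A B : (forall v : 'rV_p, v *m A = v *m B) -> A = B.
Proof. by move=> AB; apply/row_matrixP => i; rewrite !rowE. Qed.

End MatrixEntries.

Ltac mx_abel := let a := fresh in let b := fresh in
  apply/matrixP => a b; rewrite ?(mxD, mxN, mxZ) ?[(0 : 'M__) a b]mxE; ring.

Section Bilin.
Context {R : realType} {n : nat}.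
Implicit Types (A B : 'M[R]_n) (u v w : 'rV[R]_n).

Lemma bilinDl A u v w : bilin A (u + v) w = bilin A u w + bilin A v w.
Proof. by rewrite /bilin !mulmxDl mxD. Qed.
Lemma bilinNl A u w : bilin A (- u) w = - bilin A u w.
Proof. by rewrite /bilin !mulNmx mxN. Qed.
Lemma bilinZl A k u w : bilin A (k *: u) w = k * bilin A u w.
Proof. by rewrite /bilin -!scalemxAl mxE. Qed.
Lemma bilinD A B u w : bilin (A + B) u w = bilin A u w + bilin B u w.
Proof. by rewrite /bilin mulmxDr mulmxDl mxD. Qed.

Lemma bilin_inj A B : (forall u v, bilin A u v = bilin B u v) -> A = B.
Proof.
move=> AB; apply/matrixP => a b; have := AB (delta_mx 0 a) (delta_mx 0 b).
by rewrite /bilin -!rowE trmx_delta -!colE !mxE.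
Qed.

End Bilin.

Section Comb.
Context {R : realType} {n : nat}.
Implicit Types (F : 'I_n -> 'I_n -> 'rV[R]_n -> 'rV[R]_n) (u v w x : 'rV[R]_n).

(** The matrix of v |-> sum_(a,b) u_a v_b F_ab. Keeping u apart makes a
    connection in a chart a family of matrices acting on row vectors, so that
    covariant derivatives are matrix products. *)
Definition christ_mx F u x : 'M[R]_n :=
  \matrix_(b, d) \sum_a u 0 a * F a b x 0 d.

Definition dchrist_mx F w u x : 'M[R]_n :=
  christ_mx (fun a b => 'D_w (F a b)) u x.

Lemma christ_mxE F u x b d : christ_mx F u x b d = \sum_a u 0 a * F a b x 0 d.
Proof. by rewrite mxE. Qed.

Lemma christ_sumE F x u v : christ_sum F x u v = v *m christ_mx F u x.
Proof.
apply/rowP => d; rewrite /christ_sum summxE mxE.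
under eq_bigr do rewrite summxE.
rewrite exchange_big; apply: eq_bigr => b _; rewrite mxE mulr_sumr.
by apply: eq_bigr => a _; rewrite mxE mulrAC mulrC.
Qed.

Lemma christ_mx_linear F x k u v :
  christ_mx F (k *: u + v) x = k *: christ_mx F u x + christ_mx F v x.
Proof.
apply/matrixP => b d; rewrite !mxE mulr_sumr -big_split; apply: eq_bigr => a _.
by rewrite !mxE mulrDl mulrA.
Qed.

(** The chain rule with a moving direction w and a moving point T; the moving
    direction occurs in the transformation law of Christoffel symbols. *)
Lemma is_derive_christ_mx F (U : set 'rV[R]_n) (V : normedModType R)
    (w : V -> 'rV[R]_n) (T : V -> 'rV[R]_n) (x v : V) dw :
  (forall a b, smooth U (F a b)) -> U (T x) ->
  differentiable T x -> is_derive x v w dw ->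
  is_derive x v (fun z => christ_mx F (w z) (T z))
    (christ_mx F dw (T x) + dchrist_mx F ('D_v T x) (w x) (T x)).
Proof.
move=> sF UT dT /is_derive_mxP hw; apply/is_derive_mxP => b d.
have -> : (fun y => christ_mx F (w y) (T y) b d) =
    \sum_a ((fun y => w y 0 a) * (fun y => F a b (T y) 0 d)).
  by apply/funext => y; rewrite fct_sumE mxE.
have -> : (christ_mx F dw (T x) + dchrist_mx F ('D_v T x) (w x) (T x)) b d =
    \sum_a (w x 0 a *: 'D_('D_v T x) (F a b) (T x) 0 d
            + F a b (T x) 0 d *: dw 0 a).
  rewrite !mxE -big_split; apply: eq_bigr => a _ /=; rewrite addrC.
  by congr (_ + _); exact: mulrC.
apply: is_derive_sum => a; apply: is_deriveM.
by move: 0 d; apply/is_derive_mxP/is_derive_comp => //;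
  exact: smooth_differentiable (sF a b) UT.
Qed.

Lemma christ_mx_derive F (U : set 'rV[R]_n) x v u :
  (forall a b, smooth U (F a b)) -> U x ->
  is_derive x v (christ_mx F u) (dchrist_mx F v u x).
Proof.
move=> sF Ux.
have := @is_derive_christ_mx F U _ (cst u) id x v 0 sF Ux _ _.
rewrite derive_id.
have -> : christ_mx F 0 x = 0.
  by apply/matrixP => b d; rewrite !mxE big1 // => a _; rewrite mxE mul0r.
by rewrite add0r; apply; exact: ex_diff.
Qed.

Lemma dchrist_mx_linear F (U : set 'rV[R]_n) x u k v w :
  (forall a b, smooth U (F a b)) -> U x ->
  dchrist_mx F (k *: v + w) u x = k *: dchrist_mx F v u x + dchrist_mx F w u x.
Proof.
move=> sF Ux; apply/matrixP => b d.
rewrite !mxE mulr_sumr -big_split; apply: eq_bigr => a _ /=.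
by rewrite deriveD_dir ?mxE ?mulrDr 1?mulrCA //;
  exact: smooth_differentiable (sF a b) Ux.
Qed.

Lemma dchrist_mx_linear_r F w x k u v :
  dchrist_mx F w (k *: u + v) x = k *: dchrist_mx F w u x + dchrist_mx F w v x.
Proof. exact: christ_mx_linear. Qed.

Lemma dchrist_mx_schwarz F (U : set 'rV[R]_n) x u v w :
  open U -> (forall a b, smooth U (F a b)) -> U x ->
  dchrist_mx (fun a b => 'D_v (F a b)) w u x = dchrist_mx (fun a b => 'D_w (F a b)) v u x.
Proof.
move=> oU sF Ux; apply/matrixP => b d.
apply: etrans (christ_mxE _ _ _ _ _) _; apply: etrans (esym (christ_mxE _ _ _ _ _)).
apply: eq_bigr => a _.
have E := smooth_schwarz w v oU (sF a b) Ux.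
exact: (congr1 (fun z : 'rV_n => u 0 a * z 0 d) E).
Qed.

End Comb.

(** * The curvature of a connection in a chart *)

#[local] Opaque derive christ_mx dchrist_mx.

Section Connection.
Context {R : realType} {n : nat} {M : manifold R n} (D : connection M).
Implicit Types (i j : Defs.index M) (u v w x : 'rV[R]_n).

Definition conn_mx i u x : 'M[R]_n := christ_mx (christoffel D i) u x.
Definition dconn_mx i w u x : 'M[R]_n := dchrist_mx (christoffel D i) w u x.

(** The order of the products is reversed with respect to the usual
    formula, as matrices act on row vectors from the right. *)
Definition curv_mx i u v x : 'M[R]_n :=
  dconn_mx i u v x - dconn_mx i v u x + conn_mx i v x *m conn_mx i u x - conn_mx i u x *m conn_mx i v x.

Lemma open_cod i : open (cod i : set 'rV[R]_n).
Proof. exact: cod_open. Qed.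

Lemma cod_chart i p : dom i p -> cod i (chart i p).
Proof. by exists p. Qed.

Lemma is_derive_conn_mx i u w x : cod i x -> is_derive x w (conn_mx i u) (dconn_mx i w u x).
Proof. by move=> Ux; exact: christ_mx_derive (@christoffel_smooth _ _ _ D i) Ux. Qed.

Lemma nabla_cstE i u Y x :
  nabla D i (cst u) Y x = 'D_u Y x + Y x *m conn_mx i u x.
Proof. by rewrite /nabla christ_sumE. Qed.

Lemma nabla_cst2 i u v : nabla D i (cst u) (cst v) = fun x => v *m conn_mx i u x.
Proof. by apply/funext => x; rewrite nabla_cstE derive_cst add0r. Qed.

Lemma is_derive_mulmxl (V : normedModType R) p q r (A : 'M[R]_(p, q))
    (f : V -> 'M[R]_(q, r)) (x v : V) df :
  is_derive x v f df -> is_derive x v (fun y => A *m f y) (A *m df).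
Proof.
move=> hf; have := is_derive_mulmx (is_derive_cst A x v) hf.
by rewrite mul0mx add0r.
Qed.

Lemma is_derive_mulmxr (V : normedModType R) p q r (A : 'M[R]_(q, r))
    (f : V -> 'M[R]_(p, q)) (x v : V) df :
  is_derive x v f df -> is_derive x v (fun y => f y *m A) (df *m A).
Proof.
move=> hf; have := is_derive_mulmx hf (is_derive_cst A x v).
by rewrite mulmx0 addr0.
Qed.

Lemma curvatureE i x u v w : cod i x ->
  curvature D i x u v w = w *m curv_mx i u v x.
Proof.
move=> Ux; rewrite /curvature /curvature_field !nabla_cst2 !nabla_cstE.
have L : lie_bracket (cst u) (cst v) = cst 0.
  by apply/funext => y; rewrite /lie_bracket !derive_cst subr0.
rewrite L nabla_cst2.
have d a b : 'D_a (fun y => w *m conn_mx i b y) x = w *m dconn_mx i a b x.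
  by have [_] := is_derive_mulmxl w (is_derive_conn_mx b a Ux).
have -> : conn_mx i 0 x = 0.
  by have := christ_mx_linear (christoffel D i) x (-1) u u; rewrite !scaleN1r !addNr.
rewrite mulmx0 subr0 !d /curv_mx !mulmxDr !mulmxN !mulmxA.
move: (conn_mx i u x) (conn_mx i v x) (dconn_mx i u v x) (dconn_mx i v u x) => A B C E.
mx_abel.
Qed.

Lemma curv_mx_anti i u v x : curv_mx i u v x = - curv_mx i v u x.
Proof.
rewrite /curv_mx.
move: (conn_mx i u x) (conn_mx i v x) (dconn_mx i u v x) (dconn_mx i v u x) => A B C E.
mx_abel.
Qed.

Lemma conn_mx_linear i k u v x :
  conn_mx i (k *: u + v) x = k *: conn_mx i u x + conn_mx i v x.
Proof. exact: christ_mx_linear. Qed.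

Lemma dconn_mx_linear i k u u' v x : cod i x ->
  dconn_mx i (k *: u + u') v x = k *: dconn_mx i u v x + dconn_mx i u' v x.
Proof.
exact: (dchrist_mx_linear _ _ _ _ (@christoffel_smooth _ _ _ D i)).
Qed.

Lemma dconn_mx_linear_r i k u v v' x :
  dconn_mx i u (k *: v + v') x = k *: dconn_mx i u v x + dconn_mx i u v' x.
Proof. exact: dchrist_mx_linear_r. Qed.

Lemma curv_mx_linear i k u u' v x : cod i x ->
  curv_mx i (k *: u + u') v x = k *: curv_mx i u v x + curv_mx i u' v x.
Proof.
move=> Ux; rewrite /curv_mx conn_mx_linear dconn_mx_linear // dconn_mx_linear_r.
move: (conn_mx i u x) (conn_mx i u' x) (conn_mx i v x) => A A' B.
move: (dconn_mx i u v x) (dconn_mx i u' v x) (dconn_mx i v u x) (dconn_mx i v u' x) => C C' E E'.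
rewrite !mulmxDr !mulmxDl -!scalemxAl -!scalemxAr.
mx_abel.
Qed.

Definition ddconn_mx i u v w x : 'M[R]_n :=
  dchrist_mx (fun a b => 'D_v (christoffel D i a b)) u w x.

Lemma is_derive_dconn_mx i u v w x : cod i x ->
  is_derive x u (dconn_mx i v w) (ddconn_mx i u v w x).
Proof.
move=> Ux; apply: christ_mx_derive Ux => a b.
exact/smooth_derive/christoffel_smooth.
Qed.

Lemma ddconn_mxC i u v w x : cod i x -> ddconn_mx i u v w x = ddconn_mx i v u w x.
Proof.
move=> Ux.
exact: (dchrist_mx_schwarz _ _ _ (@open_cod i) (@christoffel_smooth _ _ _ D i) Ux).
Qed.

(** The derivative of [curv_mx] along u, see [is_derive_curv_mx]. *)
Definition dcurv_mx i u v w x : 'M[R]_n :=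
  ddconn_mx i u v w x - ddconn_mx i u w v x
  + (dconn_mx i u w x *m conn_mx i v x + conn_mx i w x *m dconn_mx i u v x)
  - (dconn_mx i u v x *m conn_mx i w x + conn_mx i v x *m dconn_mx i u w x).

Lemma is_derive_curv_mx i u v w x : cod i x ->
  is_derive x u (curv_mx i v w) (dcurv_mx i u v w x).
Proof.
move=> Ux; have dg a := is_derive_conn_mx a u Ux.
have ddg a b := is_derive_dconn_mx u a b Ux.
have p a b := is_derive_mulmx (dg a) (dg b).
exact: is_deriveB (is_deriveD (is_deriveB (ddg v w) (ddg w v)) (p w v)) (p v w).
Qed.

(** N u v w is the derivative of the curvature along u, corrected by the
    connection on its third argument and on its value only. As constant fields commute, this is
    the Jacobi identity for covariant derivatives along u, v, w. *)
Lemma bianchi2 i u v w x : cod i x ->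
  let N a b c := dcurv_mx i a b c x + curv_mx i b c x *m conn_mx i a x
                 - conn_mx i a x *m curv_mx i b c x in
  N u v w + N v w u + N w u v = 0.
Proof.
move=> Ux /=; rewrite /dcurv_mx /curv_mx.
move: (ddconn_mxC u v w Ux) (ddconn_mxC u w v Ux) (ddconn_mxC v w u Ux).
move: (ddconn_mx i u v w x) (ddconn_mx i u w v x) (ddconn_mx i v w u x).
move: (ddconn_mx i v u w x) (ddconn_mx i w u v x) (ddconn_mx i w v u x).
move=> X1 X2 X3 Y1 Y2 Y3 -> -> ->.
move: (conn_mx i u x) (conn_mx i v x) (conn_mx i w x) => A B C.
move: (dconn_mx i u v x) (dconn_mx i v w x) (dconn_mx i w u x) => A1 B1 C1.
move: (dconn_mx i v u x) (dconn_mx i w v x) (dconn_mx i u w x) => A2 B2 C2.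
rewrite !(mulmxDr, mulmxDl, mulNmx, mulmxN) !mulmxA.
mx_abel.
Qed.

End Connection.

(** * Change of charts *)

Section ChartChange.
Context {R : realType} {n : nat} {M : manifold R n} (D : connection M).
Context (i j : Defs.index M).
Implicit Types (u v w x : 'rV[R]_n) (p : M).

Definition overlap : set 'rV[R]_n := chart i @` (dom i `&` dom j).
Local Notation T := (transition i j).

Lemma transitionE p : dom i p -> T (chart i p) = chart j p.
Proof. by move=> ip; rewrite /transition /= chartK. Qed.

Lemma open_overlap : open overlap.
Proof.
rewrite openE => _ [p [ip jp] <-].
have n1 : nbhs (chart i p) (cod i).
  by apply: open_nbhs_nbhs; split; [exact: cod_open|exact: cod_chart].
have n2 : nbhs (chart i p) (unchart i @^-1` dom j).
  apply: (unchart_continuous ip); rewrite chartK //.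
  by apply: open_nbhs_nbhs; split; [exact: dom_open|].
apply: (@filterS _ _ (nbhs_filter _) _ _ _ (@filterI _ _ (nbhs_filter _) _ _ n1 n2)).
by move=> _ [[q iq <-]]; rewrite /preimage /= chartK // => jq; exists q.
Qed.

Lemma smooth_transition : smooth overlap T.
Proof. exact: transition_smooth. Qed.

Let jac x : 'M[R]_n := \matrix_(b, d) ('D_(delta_mx 0 b) T x) 0 d.
Let djac w x : 'M[R]_n := \matrix_(b, d) ('D_w ('D_(delta_mx 0 b) T) x) 0 d.
Let ddjac z w x : 'M[R]_n :=
  \matrix_(b, d) ('D_z ('D_w ('D_(delta_mx 0 b) T)) x) 0 d.

Let jacE x : overlap x -> jac x = 'J T x.
Proof.
move=> Ux; apply/matrixP => b d; rewrite mxE deriveEjacobian; last first.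
  exact: smooth_differentiable smooth_transition Ux.
by rewrite -rowE mxE.
Qed.

Let mul_jac v x : overlap x -> 'D_v T x = v *m jac x.
Proof.
move=> Ux; rewrite jacE // deriveEjacobian //.
exact: smooth_differentiable smooth_transition Ux.
Qed.

Let is_derive_jac w x : overlap x -> is_derive x w jac (djac w x).
Proof.
move=> Ux; apply/is_derive_mxP => b d.
have -> : (fun y => jac y b d) = (fun y => ('D_(delta_mx 0 b) T y) 0 d).
  by apply/funext => y; exact: mxE.
have -> : djac w x b d = ('D_w ('D_(delta_mx 0 b) T) x) 0 d by exact: mxE.
have := smooth_is_derive w (smooth_derive (delta_mx 0 b) smooth_transition) Ux.
by move=> /is_derive_mxP; exact.
Qed.

Let is_derive_djac z w x : overlap x -> is_derive x z (djac w) (ddjac z w x).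
Proof.
move=> Ux; apply/is_derive_mxP => b d.
have -> : (fun y => djac w y b d) = (fun y => ('D_w ('D_(delta_mx 0 b) T) y) 0 d).
  by apply/funext => y; exact: mxE.
have -> : ddjac z w x b d = ('D_z ('D_w ('D_(delta_mx 0 b) T)) x) 0 d.
  by exact: mxE.
have := smooth_is_derive z (smooth_derive w
  (smooth_derive (delta_mx 0 b) smooth_transition)) Ux.
by move=> /is_derive_mxP; exact.
Qed.

Let ddjacC z w x : overlap x -> ddjac z w x = ddjac w z x.
Proof.
move=> Ux; apply/matrixP => b d; apply: etrans (mxE _ _ _ _) _.
apply: etrans (esym (mxE _ _ _ _)).
have E := smooth_schwarz z w open_overlap
  (smooth_derive (delta_mx 0 b) smooth_transition) Ux.
exact: (congr1 (fun A : 'rV_n => A 0 d) E).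
Qed.

Let mul_djac v w x : overlap x -> 'D_w ('D_v T) x = v *m djac w x.
Proof.
move=> Ux.
have [] // := @is_derive_eq_near _ _ _ overlap (fun y => v *m jac y)
  ('D_v T) x w (v *m djac w x) open_overlap Ux.
- by move=> y Uy; rewrite mul_jac.
- exact/is_derive_mulmxl/is_derive_jac.
Qed.

Let djacC v w x : overlap x -> v *m djac w x = w *m djac v x.
Proof.
move=> Ux.
apply: etrans (esym (mul_djac v w Ux)) (etrans _ (mul_djac w v Ux)).
exact: smooth_schwarz open_overlap smooth_transition Ux.
Qed.

Let djacE u x : overlap x ->
  djac u x = conn_mx D i u x *m jac x - jac x *m conn_mx D j (u *m jac x) (T x).
Proof.
move=> Ux; apply: row_mulmx_inj => v; rewrite -mul_djac //.
have [p [ip jp] px] := Ux.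
have := christoffel_change D ip jp u v.
have <- : T x = chart j p by rewrite -px transitionE.
rewrite /change px -jacE // !christ_sumE => E.
by rewrite mulmxBr; apply: (canRL (addrK _)); rewrite !mulmxA.
Qed.

(** The law djac u = Gamma_u P - P Gamma'_(uP), where P is the Jacobian of the
    transition, is differentiated along a second vector. Second derivatives of P
    being symmetric, the antisymmetric part of the result is
    K(u,v) P = P K'(uP,vP). *)
Lemma curv_mx_change u v p : dom i p -> dom j p ->
  curv_mx D i u v (chart i p) *m change i j p =
  change i j p *m
    curv_mx D j (u *m change i j p) (v *m change i j p) (chart j p).
Proof.
move=> ip jp; rewrite /change; set x := chart i p.
have Ux : overlap x by exists p.
have Ti : cod i x by exact: cod_chart.
have Tj : cod j (T x) by rewrite transitionE //; exact: cod_chart.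
rewrite -transitionE // -/x -jacE //.
have dT : differentiable T x := smooth_differentiable smooth_transition Ux.
(* The transformation law for b, differentiated along a. *)
have key a b : ddjac a b x =
    (dconn_mx D i a b x *m jac x + conn_mx D i b x *m djac a x)
    - (djac a x *m conn_mx D j (b *m jac x) (T x)
       + jac x *m (conn_mx D j (b *m djac a x) (T x)
                   + dconn_mx D j (a *m jac x) (b *m jac x) (T x))).
  have d1 : is_derive x a (djac b) (ddjac a b x) by exact: is_derive_djac.
  have dj := is_derive_jac a Ux.
  have dg : is_derive x a (fun y => conn_mx D j (b *m jac y) (T y))
      (conn_mx D j (b *m djac a x) (T x)
       + dconn_mx D j (a *m jac x) (b *m jac x) (T x)).
    rewrite -(mul_jac a Ux).
    exact: (is_derive_christ_mx (@christoffel_smooth _ _ _ D j) Tj dT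
             (is_derive_mulmxl b dj)).
  have d2 := is_deriveB (is_derive_mulmx (is_derive_conn_mx D b a Ti) dj)
    (is_derive_mulmx dj dg).
  have d3 := @is_derive_eq_near _ _ _ overlap _ (djac b) x a _ open_overlap Ux
    (fun y Uy => esym (djacE b Uy)) d2.
  by rewrite -(@derive_val _ _ _ _ _ _ _ d1) (@derive_val _ _ _ _ _ _ _ d3).
have := etrans (esym (key u v)) (etrans (ddjacC u v Ux) (key v u)).
rewrite (djacC v u Ux); move: (conn_mx D j (u *m djac v x) (T x)) => Z.
rewrite (djacE u Ux) (djacE v Ux) /curv_mx.
move: (conn_mx D i u x) (conn_mx D i v x) (dconn_mx D i u v x) (dconn_mx D i v u x) => A B C E.
move: (conn_mx D j (u *m jac x) (T x)) (conn_mx D j (v *m jac x) (T x)) => A' B'.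
move: (dconn_mx D j (u *m jac x) (v *m jac x) (T x)) => C'.
move: (dconn_mx D j (v *m jac x) (u *m jac x) (T x)) => E'.
move: (jac x) => P.
rewrite !(mulmxDr, mulmxDl, mulNmx, mulmxN) !mulmxA => H.
apply/matrixP => a b; move/matrixP: H => /(_ a b).
rewrite !(mxD, mxN); lra.
Qed.

End ChartChange.

(** * Curvature of a Kähler manifold in a chart *)

Section KahlerCurvature.
Context {R : realType} {n : nat} {M : kahler R n}.
Implicit Types (i : Defs.index M) (u v w x : 'rV[R]_n).

Local Notation conn := (conn_mx (lc M)).
Local Notation dconn := (dconn_mx (lc M)).
Local Notation curv := (curv_mx (lc M)).

Lemma conn_mx_torsion i u v x : cod i x -> v *m conn i u x = u *m conn i v x.
Proof.
move=> Ux.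
have [/(_ x Ux) E _] := @lcP _ _ M i (cst u) (cst v) (smooth_cst _ u) (smooth_cst _ v).
apply/eqP; rewrite -subr_eq0; apply/eqP; move: E.
by rewrite !nabla_cst2 /lie_bracket !derive_cst subr0.
Qed.

Lemma dconn_mx_torsion i u v w x : cod i x -> v *m dconn i w u x = u *m dconn i w v x.
Proof.
move=> Ux.
have d1 := is_derive_mulmxl v (is_derive_conn_mx (lc M) u w Ux).
have d2 := is_derive_mulmxl u (is_derive_conn_mx (lc M) v w Ux).
have d3 := is_derive_eq_near (@open_cod _ _ M i) Ux
  (fun y Uy => conn_mx_torsion u v Uy) d1.
by rewrite -(@derive_val _ _ _ _ _ _ _ d2) (@derive_val _ _ _ _ _ _ _ d3).
Qed.

Lemma derive_metric i u x : cod i x ->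
  'D_u (metric i) x = conn i u x *m metric i x + metric i x *m (conn i u x)^T.
Proof.
move=> Ux; apply: bilin_inj => v w.
have [_ /(_ (cst w) (smooth_cst _ w) x Ux)] :=
  @lcP _ _ M i (cst u) (cst v) (smooth_cst _ u) (smooth_cst _ v).
have -> : 'D_(cst u x) (fun y => bilin (metric i y) (cst v y) (cst w y)) x =
    bilin ('D_u (metric i) x) v w.
  have d := is_derive_mulmxr w^T (is_derive_mulmxl v
    (smooth_is_derive u (metric_smooth (r := M) i) Ux)).
  by have [_] := (is_derive_mxP _ _ _ _).1 d 0 0.
rewrite !nabla_cst2 => ->; rewrite bilinD /bilin /= trmx_mul !mulmxA //.
Qed.

Lemma derive_cplx i u x : cod i x ->
  'D_u (cplx i) x = conn i u x *m cplx i x - cplx i x *m conn i u x.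
Proof.
move=> Ux; apply: row_mulmx_inj => v.
have := @cplx_parallel _ _ M i (cst u) (cst v) (smooth_cst _ u) (smooth_cst _ v) x Ux.
rewrite nabla_cst2 nabla_cstE.
have [_ ->] := is_derive_mulmxl v (smooth_is_derive u (cplx_smooth (k := M) i) Ux).
rewrite mulmxBr !mulmxA => <-; by rewrite addrK.
Qed.

(** The metric is parallel; antisymmetrize its second derivative, expressed
    through the connection. *)
Lemma curv_mx_skew i u v x : cod i x ->
  curv i u v x *m metric i x = - (metric i x *m (curv i u v x)^T).
Proof.
move=> Ux; have sg := metric_smooth (r := M) i.
have dd a b : 'D_a ('D_b (metric i)) x =
    dconn i a b x *m metric i x
    + conn i b x *m (conn i a x *m metric i x + metric i x *m (conn i a x)^T)
    + ((conn i a x *m metric i x + metric i x *m (conn i a x)^T) *m (conn i b x)^T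
    + metric i x *m (dconn i a b x)^T).
  have dg : is_derive x a (metric i)
      (conn i a x *m metric i x + metric i x *m (conn i a x)^T).
    by rewrite -derive_metric //; exact: smooth_is_derive sg Ux.
  have dG := is_derive_conn_mx (lc M) b a Ux.
  have d := is_deriveD (is_derive_mulmx dG dg)
    (is_derive_mulmx dg (is_derive_trmx dG)).
  have d' := is_derive_eq_near (@open_cod _ _ M i) Ux
    (fun y Uy => esym (derive_metric b Uy)) d.
  exact: derive_val.
have := etrans (esym (dd u v)) (etrans (smooth_schwarz u v (@open_cod _ _ M i) sg Ux) (dd v u)).
rewrite /curv_mx.
move: (metric i x) (conn i u x) (conn i v x) (dconn i u v x) (dconn i v u x).
move=> G A B A' B'; rewrite !(trmxD, trmxN) !trmx_mul; move: A^T B^T A'^T B'^T => C E C' E'.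
rewrite !(mulmxDr, mulmxDl, mulNmx, mulmxN) !mulmxA => H.
apply/matrixP => a b; move/matrixP: H => /(_ a b).
rewrite !(mxD, mxN); lra.
Qed.

(** The same argument as for the metric, applied to the complex structure. *)
Lemma curv_mx_cplx i u v x : cod i x ->
  curv i u v x *m cplx i x = cplx i x *m curv i u v x.
Proof.
move=> Ux; have sJ := cplx_smooth (k := M) i.
have dd a b : 'D_a ('D_b (cplx i)) x =
    dconn i a b x *m cplx i x
    + conn i b x *m (conn i a x *m cplx i x - cplx i x *m conn i a x)
    - ((conn i a x *m cplx i x - cplx i x *m conn i a x) *m conn i b x
    + cplx i x *m dconn i a b x).
  have dg : is_derive x a (cplx i)
      (conn i a x *m cplx i x - cplx i x *m conn i a x).
    by rewrite -derive_cplx //; exact: smooth_is_derive sJ Ux.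
  have dG := is_derive_conn_mx (lc M) b a Ux.
  have d := is_deriveB (is_derive_mulmx dG dg) (is_derive_mulmx dg dG).
  have d' := is_derive_eq_near (@open_cod _ _ M i) Ux
    (fun y Uy => esym (derive_cplx b Uy)) d.
  exact: derive_val.
have := etrans (esym (dd u v)) (etrans (smooth_schwarz u v (@open_cod _ _ M i) sJ Ux) (dd v u)).
rewrite /curv_mx.
move: (cplx i x) (conn i u x) (conn i v x) (dconn i u v x) (dconn i v u x).
move=> G A B A' B'.
rewrite !(mulmxDr, mulmxDl, mulNmx, mulmxN) !mulmxA => H.
apply/matrixP => a b; move/matrixP: H => /(_ a b).
rewrite !(mxD, mxN); lra.
Qed.

(** Torsion-freeness, v Gamma_u = u Gamma_v, and its derivative make the terms
    cancel in pairs. *)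
Lemma curv_mx_bianchi i u v w x : cod i x ->
  w *m curv i u v x + u *m curv i v w x + v *m curv i w u x = 0.
Proof.
move=> Ux; rewrite /curv_mx !(mulmxDr, mulmxN) !mulmxA.
move: (dconn_mx_torsion v w u Ux) (dconn_mx_torsion w u v Ux) (dconn_mx_torsion u v w Ux).
move: (conn_mx_torsion v w Ux) (conn_mx_torsion w u Ux) (conn_mx_torsion u v Ux).
move: (conn i u x) (conn i v x) (conn i w x) => A B C.
move: (dconn i u v x) (dconn i v w x) (dconn i w u x) => A1 B1 C1.
move: (dconn i v u x) (dconn i w v x) (dconn i u w x) => A2 B2 C2.
by move=> -> -> -> -> -> ->; mx_abel.
Qed.

Lemma hermitian_at i x : cod i x ->
  hermitian_space (bilin (metric i x)) (fun u => u *m cplx i x).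
Proof.
move=> Ux; split => /=.
- by move=> a u v w; rewrite bilinDl bilinZl.
- by move=> u v; exact: Defs.metric_sym.
- by move=> u; apply: metric_pos Ux u.
- by move=> a u v; rewrite mulmxDl -scalemxAl.
- by move=> u; rewrite -mulmxA cplx_sqr // mulmxN mulmx1.
- by move=> u v; apply: cplx_hermitian Ux u v.
Qed.

Lemma kahler_tensor_at i x : cod i x ->
  kahler_tensor (fun u => u *m cplx i x)
    (fun a b c d => bilin (metric i x) (c *m curv i a b x) d).
Proof.
move=> Ux; split => /=.
- move=> k a a' b c d.
  by rewrite curv_mx_linear // mulmxDr -scalemxAr bilinDl bilinZl.
- by move=> a b c d; rewrite curv_mx_anti mulmxN bilinNl.
- move=> a b c d; rewrite (Defs.metric_sym Ux (d *m _)) /bilin trmx_mul.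
  by rewrite -(mulmxA c _ (metric i x)) curv_mx_skew // mulmxN mulNmx mxN !mulmxA.
- move=> a b c d; rewrite -!bilinDl (curv_mx_bianchi a b c Ux).
  by rewrite /bilin !mul0mx mxE.
- move=> a b c d.
  by rewrite -mulmxA -curv_mx_cplx // mulmxA cplx_hermitian.
Qed.

End KahlerCurvature.

(** * Schur's lemma *)

(** Fewer than n linear conditions on a vector of dimension n. *)
Lemma orthogonal_exists (R : realType) n (G : 'M[R]_n) (t : seq 'rV[R]_n) :
  (size t < n)%N -> exists2 v, v != 0 & forall y, y \in t -> bilin G v y = 0.
Proof.
move=> tn; pose B := G *m (\matrix_(s < size t) t`_s)^T.
have k0 : kermx B != 0.
  rewrite -mxrank_eq0 mxrank_ker -lt0n subn_gt0.
  exact: leq_ltn_trans (rank_leq_col _) tn.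
have /rowV0Pn[v vB v0] := k0; exists v => // y /(nthP 0)[s st <-].
move/sub_kermxP: vB => /matrixP/(_ 0 (Ordinal st)).
rewrite mulmxA [X in _ = X]mxE => <-; rewrite /bilin.
rewrite [LHS]mxE [RHS]mxE; apply: eq_bigr => a _; by rewrite !mxE.
Qed.

Lemma mul_mx11 (R : comPzRingType) n (A : 'M[R]_1) (a : 'rV[R]_n) :
  A *m a = A 0 0 *: a.
Proof. by rewrite [A]mx11_scalar mul_scalar_mx mxE eqxx. Qed.

Lemma is_derive_scale (R : realType) (V : normedModType R) p q (f : V -> R)
    (A : V -> 'M[R]_(p, q)) x v df dA :
  is_derive x v f df -> is_derive x v A dA ->
  is_derive x v (fun y => f y *: A y) (df *: A x + f x *: dA).
Proof.
move=> hf /is_derive_mxP hA; apply/is_derive_mxP => a b.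
have -> : (fun y => (f y *: A y) a b) = f * (fun y => A y a b).
  by apply/funext => y; rewrite mxE.
have -> : (df *: A x + f x *: dA) a b = f x *: dA a b + A x a b *: df.
  rewrite mxD !mxZ addrC; congr (_ + _); exact: mulrC.
exact: is_deriveM.
Qed.

Section Schur.
Context {R : realType} {n : nat} {M : kahler R n} (i : Defs.index M).
Implicit Types (a b c u v w x y : 'rV[R]_n) (k : R).

Local Notation conn := (conn_mx (lc M) i).
Local Notation curv := (curv_mx (lc M) i).
Local Notation g := (metric i).
Local Notation Jm := (cplx i).
Local Notation ip x := (bilin (metric i x)).
Local Notation J x := (fun u => u *m cplx i x).

(** The numerator of the holomorphic sectional curvature of u. *)
Definition holcurv u x : R :=
  ip x (u *m Jm x *m curv u (u *m Jm x) x) u.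

(** [model_curv] as a matrix acting on its third argument, see [mul_model_mx]. *)
Definition model_mx a b x : 'M[R]_n :=
  g x *m b^T *m a - g x *m a^T *m b + g x *m (b *m Jm x)^T *m (a *m Jm x)
  - g x *m (a *m Jm x)^T *m (b *m Jm x) - (2 * ip x (a *m Jm x) b) *: Jm x.

Lemma mul_model_mx x a b c : cod i x ->
  c *m model_mx a b x = model_curv (ip x) (J x) a b c.
Proof.
move=> Ux; have s := ip_sym (hermitian_at Ux).
rewrite /model_mx /model_curv !(mulmxDr, mulmxN) -!scalemxAr !mulmxA !mul_mx11.
by rewrite -!scalemxAl -!/(bilin _ _ _) !(s c).
Qed.

Lemma curv_mx_of_holcurv x k : cod i x ->
  (forall u, holcurv u x = 4 * k * ip x u u ^+ 2) ->
  forall a b, curv a b x = k *: model_mx a b x.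
Proof.
move=> Ux hk a b; apply: row_mulmx_inj => c.
rewrite -scalemxAr mul_model_mx //; apply: (ip_inj (hermitian_at Ux)) => d.
rewrite (ipZl (hermitian_at Ux)).
exact: (model_curv_unique (hermitian_at Ux) (kahler_tensor_at Ux) hk a b c d).
Qed.

Lemma model_mxC x a b : cod i x -> model_mx a b x = - model_mx b a x.
Proof.
move=> Ux; apply: row_mulmx_inj => c; rewrite mulmxN !mul_model_mx //.
apply: (ip_inj (hermitian_at Ux)) => d; rewrite (ipNl (hermitian_at Ux)).
exact: (T_anti12 (model_curv_kahler (hermitian_at Ux))).
Qed.

(** The model tensor is parallel because the metric and the complex structure
    are: its derivative is the action of the connection on the arguments and on
    the value. *)
Lemma is_derive_model_mx x u v w : cod i x ->
  is_derive x u (model_mx v w)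
    (model_mx (v *m conn u x) w x + model_mx v (w *m conn u x) x
     + conn u x *m model_mx v w x - model_mx v w x *m conn u x).
Proof.
move=> Ux.
have dg : is_derive x u g (conn u x *m g x + g x *m (conn u x)^T).
  by rewrite -derive_metric //; exact: smooth_is_derive (metric_smooth (r := M) i) Ux.
have dJ : is_derive x u Jm (conn u x *m Jm x - Jm x *m conn u x).
  by rewrite -derive_cplx //; exact: smooth_is_derive (cplx_smooth (k := M) i) Ux.
have d1 a b := is_derive_mulmxr a (is_derive_mulmxr b^T dg).
have dJ' a := is_derive_mulmxl a dJ.
have d2 a b := is_derive_mulmx (is_derive_mulmx dg (is_derive_trmx (dJ' b))) (dJ' a).
have d3 : is_derive x u (fun y => 2 * ip y (v *m Jm y) w)
    (2 * (ip x (v *m conn u x *m Jm x) w + ip x (v *m Jm x) (w *m conn u x))).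
  have /is_derive_mxP/(_ 0 0) d := is_derive_mulmxr w^T (is_derive_mulmx (dJ' v) dg).
  apply: (@is_derive_eq _ _ _ _ _ _ _ _ (is_deriveZ 2 d)); congr (2 * _).
  rewrite /bilin trmx_mul.
  move: (g x) (Jm x) (conn u x) => G I A; move: A^T => A'.
  rewrite -mxD; congr (fun_of_matrix _ 0 0).
  rewrite !(mulmxDr, mulmxDl, mulmxN, mulNmx) !mulmxA; mx_abel.
have d4 := is_deriveB (is_deriveB (is_deriveD (is_deriveB (d1 v w) (d1 w v))
  (d2 v w)) (d2 w v)) (is_derive_scale d3 dJ).
apply: (@is_derive_eq _ _ _ _ _ _ _ _ d4); rewrite /model_mx /bilin !trmx_mul !(trmxD, trmxN) !trmx_mul.
move: (g x) (Jm x) (conn u x) => G I A; move: A^T I^T v^T w^T => A' I' v' w'.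
rewrite !(mulmxDr, mulmxDl, mulmxN, mulNmx) -?scalemxAl -?scalemxAr !mulmxA.
apply/matrixP => a b; rewrite !(mxD, mxN, mxZ); ring.
Qed.

Lemma curv_mx_linear_r k u v v' x : cod i x ->
  curv u (k *: v + v') x = k *: curv u v x + curv u v' x.
Proof.
move=> Ux; rewrite !(curv_mx_anti _ _ u) curv_mx_linear // scalerN.
by rewrite opprD.
Qed.

Lemma curv_mx_sum_r u w x : cod i x ->
  curv u w x = \sum_b w 0 b *: curv u (delta_mx 0 b) x.
Proof.
move=> Ux; rewrite {1}[w]row_sum_delta.
elim/big_rec2: _ => [|b A v _ <-]; last by rewrite curv_mx_linear_r.
have := curv_mx_linear_r (-1) u 0 0 Ux; rewrite !scaleN1r addNr.
by rewrite addNr.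
Qed.

(** The second argument of the curvature, u J, varies with the point; expanding
    it in the standard basis reduces to [curv_mx] with constant arguments. *)
Lemma derivable_holcurv u v x : cod i x -> derivable (holcurv u) x v.
Proof.
move=> Ux; pose s (b : 'I_n) y := (u *m Jm y) 0 b.
pose t (b : 'I_n) y := (u *m Jm y *m curv u (delta_mx 0 b) y *m g y *m u^T) 0 0.
have sJ := smooth_is_derive v (cplx_smooth (k := M) i) Ux.
have sg := smooth_is_derive v (metric_smooth (r := M) i) Ux.
have ds (b : 'I_n) : is_derive x v (s b) ('D_v (s b) x).
  apply: derivableP; have /is_derive_mxP/(_ 0 b)[] := is_derive_mulmxl u sJ.
  by [].
have dt (b : 'I_n) : is_derive x v (t b) ('D_v (t b) x).
  have := is_derive_mulmxr u^T (is_derive_mulmx (is_derive_mulmx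
    (is_derive_mulmxl u sJ)
    (is_derive_curv_mx (lc M) v u (delta_mx 0 b) Ux)) sg).
  by move=> /is_derive_mxP/(_ 0 0)[]/derivableP.
have d := is_derive_sum (fun b : 'I_n => is_deriveM (ds b) (dt b)).
have [] // := @is_derive_eq_near _ _ _ (cod i) _ (holcurv u) x v _
  (@open_cod _ _ M i) Ux _ d.
move=> y Uy; rewrite fct_sumE /holcurv (curv_mx_sum_r u (u *m Jm y) Uy).
rewrite /bilin mulmx_sumr !mulmx_suml summxE; apply: eq_bigr => b _.
by rewrite -scalemxAr -!scalemxAl mxE.
Qed.

(** In the second Bianchi identity for K = k K0, the contributions of the
    parallel tensor K0 cancel and
    dk(u) K0(v,w) + dk(v) K0(w,u) + dk(w) K0(u,v) = 0.
    With v orthogonal to u and Ju, and w = Jv, applying this to v and pairing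
    with w leaves only the first term, -4 dk(u) |v|^4. Dimension at least 3 is
    what makes such a v exist. *)
Lemma schur (k : 'rV[R]_n -> R) : (3 <= n)%N ->
  (forall y, cod i y -> forall u, holcurv u y = 4 * k y * ip y u u ^+ 2) ->
  forall x u, cod i x -> is_derive x u k 0.
Proof.
move=> n3 hk x u Ux.
pose v0 : 'rV[R]_n := const_mx 1.
have v00 : v0 != 0.
  apply/eqP => /rowP/(_ (Ordinal (leq_trans (isT : (0 < 3)%N) n3))).
  by rewrite !mxE => /eqP; rewrite oner_eq0.
(* The curvature of one vector determines k, which is therefore derivable. *)
have kE y : cod i y -> (holcurv v0 * (fun y => (4 * ip y v0 v0 ^+ 2)^-1)) y = k y.
  move=> Uy; rewrite -[LHS]/(holcurv v0 y * (4 * ip y v0 v0 ^+ 2)^-1) hk //.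
  have := Defs.metric_pos Uy v00; move: (ip y v0 v0) => t t0.
  by field; rewrite gt_eqF.
have dk w : derivable k x w.
  have dh := derivableP (@derivable_holcurv v0 w x Ux).
  have dq : derivable (fun y => 4 * ip y v0 v0 ^+ 2) x w.
    have sg := smooth_is_derive w (metric_smooth (r := M) i) Ux.
    have := is_derive_mulmxr v0^T (is_derive_mulmxl v0 sg).
    move=> /is_derive_mxP/(_ 0 0)[d _].
    have -> : (fun y => 4 * ip y v0 v0 ^+ 2) = cst 4 *
        ((fun y => ip y v0 v0) * (fun y => ip y v0 v0)).
      by apply/funext => y; rewrite expr2.
    exact: derivableM (derivable_cst _ _ _) (derivableM d d).
  have q0 : 4 * ip x v0 v0 ^+ 2 != 0.
    by rewrite mulf_neq0 ?expf_neq0 ?pnatr_eq0 // gt_eqF // Defs.metric_pos.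
  pose q y := 4 * ip y v0 v0 ^+ 2.
  have dV := derivableP (@derivableV _ _ q x w q0 dq).
  have dhV := is_deriveM dh dV.
  by have [] := is_derive_eq_near (@open_cod _ _ M i) Ux kE dhV.
have eqK a b y (Uy : cod i y) : k y *: model_mx a b y = curv a b y.
  by rewrite (curv_mx_of_holcurv Uy (hk y Uy)).
have key a b c : dcurv_mx (lc M) i a b c x + curv b c x *m conn a x
      - conn a x *m curv b c x =
    'D_a k x *: model_mx b c x
    + k x *: (model_mx (b *m conn a x) c x + model_mx b (c *m conn a x) x).
  have dK := is_derive_scale (derivableP (dk a)) (is_derive_model_mx a b c Ux).
  have d2 := is_derive_eq_near (@open_cod _ _ M i) Ux (fun y Uy => eqK b c y Uy) dK.
  have [_ d3] := is_derive_curv_mx (lc M) a b c Ux.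
  have [_ d4] := d2.
  rewrite -d3 d4 -(eqK b c x Ux).
  move: ('D_a k x) (k x) (model_mx b c x) (conn a x) => t1 t2 A B.
  move: (model_mx _ c x) (model_mx b _ x) => C E.
  by rewrite -scalemxAl -scalemxAr; mx_abel.
have [v v0' vP] := @orthogonal_exists R n (g x) [:: u; u *m Jm x] n3.
have vu : ip x v u = 0 by apply: vP; rewrite inE eqxx.
have vJu : ip x v (u *m Jm x) = 0 by apply: vP; rewrite !inE eqxx orbT.
pose w := v *m Jm x.
have B : 'D_u k x *: model_mx v w x + 'D_v k x *: model_mx w u x
    + 'D_w k x *: model_mx u v x = 0.
  apply: etrans (bianchi2 (lc M) u v w Ux); cbv zeta.
  rewrite (key u v w) (key v w u) (key w u v).
  rewrite (conn_mx_torsion u v Ux) (conn_mx_torsion v w Ux) (conn_mx_torsion w u Ux).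
  rewrite (model_mxC w (u *m conn v x) Ux) (model_mxC (w *m conn u x) v Ux).
  rewrite (model_mxC u (v *m conn w x) Ux).
  move: (model_mx (u *m conn v x) w x) (model_mx v (w *m conn u x) x).
  move: (model_mx (v *m conn w x) u x) => X Y Z.
  move: ('D_u k x) ('D_v k x) ('D_w k x) (k x) => d1 d2 d3 d4.
  move: (model_mx v w x) (model_mx w u x) (model_mx u v x) => C1 C2 C3.
  mx_abel.
have := congr1 (fun A => ip x (v *m A) w) B.
have HS := hermitian_at Ux.
rewrite !(mulmxDr) -!scalemxAr !mul_model_mx // mulmx0 !(ipE HS).
have Jv : v *m Jm x *m Jm x = - v by exact: (JJ HS).
have s := ip_sym HS.
rewrite /w !Jv !(ipE HS) !(cplx_hermitian Ux).
have e1 : ip x (v *m Jm x) v = 0 := ip_Jself HS v.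
have e2 : ip x v (v *m Jm x) = 0 by rewrite s.
have e3 : ip x u v = 0 by rewrite s.
have e4 : ip x (u *m Jm x) v = 0 by rewrite s.
have e5 : ip x u (v *m Jm x) = 0.
  have := ip_Jl HS u v; rewrite /= e4 => /eqP.
  by rewrite eq_sym oppr_eq0 => /eqP.
rewrite e1 e2 e3 e4 e5 vu => E.
have vv : ip x v v != 0 by rewrite gt_eqF // Defs.metric_pos.
have D0 : 'D_u k x = 0.
  have {}E : ('D_u k x * ip x v v) * ip x v v = 0 by lra.
  by move/eqP: E; rewrite !mulf_eq0 (negbTE vv) !orbF => /eqP.
by rewrite -[X in is_derive _ _ _ X]D0; exact: derivableP.
Qed.

End Schur.

(** * Special submanifolds through a point *)

(** Separates even and odd indices, that is, the vectors of a unitary frame from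
    their images under J. *)
Lemma big_double (R : nmodType) (r : nat) (f : nat -> R) :
  \sum_(s < 2 * r) f s = \sum_(a < r) (f (a.*2) + f (a.*2.+1)).
Proof.
elim: r => [|r IH]; first by rewrite muln0 !big_ord0.
rewrite [RHS]big_ord_recr /= -IH mulnS addnC addn2 !big_ord_recr /=.
by rewrite addrA mul2n.
Qed.

Section Gram.
Context {R : realType} {n k : nat} (G : 'M[R]_n) (v : 'I_k -> 'rV[R]_n).
Let A := \matrix_a v a.

Lemma gram_entry a b : (A *m G *m A^T) a b = bilin G (v a) (v b).
Proof.
rewrite /bilin [LHS]mxE [RHS]mxE; apply: eq_bigr => c _.
by rewrite !mxE; congr (_ * _); apply: eq_bigr => d _; rewrite mxE.
Qed.

Lemma bilin_span u w : (forall a b, bilin G (v a) (v b) = 0) ->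
  (u <= A)%MS -> (w <= A)%MS -> bilin G u w = 0.
Proof.
move=> v0 /submxP[B ->] /submxP[C ->].
have A0 : A *m G *m A^T = 0.
  by apply/matrixP => a b; rewrite gram_entry v0 mxE.
by rewrite /bilin trmx_mul !mulmxA -(mulmxA B) -(mulmxA B) A0 mulmx0 mul0mx mxE.
Qed.

Lemma orthonormal_rank : (forall a b, bilin G (v a) (v b) = (a == b)%:R) ->
  \rank A = k.
Proof.
move=> ov; apply/eqP; rewrite -/(row_free _); apply/row_freeP.
by exists (G *m A^T); apply/matrixP => a b; rewrite mulmxA gram_entry ov mxE.
Qed.

End Gram.

Section SpecialPoint.
Context {R : realType} {n : nat} {M : kahler R n} (i : Defs.index M) (p : M).
Context (ip_dom : dom i p).
Implicit Types (u v w y z : 'rV[R]_n) (s : seq 'rV[R]_n).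

Local Notation x := (chart i p).
Local Notation ip := (bilin (metric i x)).
Local Notation J := (fun u => u *m cplx i x).
Local Notation curv := (curv_mx (lc M) i).
Local Notation T := (fun a b c d => ip (c *m curv a b x) d).
Local Notation frame := (frame ip J).

Let Ux : cod i x := cod_chart ip_dom.
Let HS := hermitian_at Ux.
Let HT := kahler_tensor_at Ux.

Lemma RmE u v w : Rm i p u v w = w *m curv u v x.
Proof. exact: curvatureE. Qed.

(** The sum of R(v_a,w)v_a lies in W, whereas z is orthogonal to W. *)
Lemma special_sum k (v : 'I_k -> 'rV[R]_n) (W : 'M[R]_n) w z :
  special_submanifold_tangent k i p W -> (\matrix_a v a == W)%MS ->
  (forall a b, inner i p (v a) (v b) = (a == b)%:R) -> (w <= W)%MS ->
  (forall a, ip (v a) z = 0) -> \sum_a T (v a) w (v a) z = 0.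
Proof.
move=> [S [f [_ _ sp [q [qp qW]]]]] vW ov wW vz.
have [a aq] := dom_cover q.
have fqi : dom i (f q) by rewrite qp.
have dW := qW a aq.
have vD : (\matrix_s v s == dmap f a i q)%MS.
  exact/eqmxP/(eqmx_trans (eqmxP vW) (eqmx_sym (eqmxP dW))).
have wD : (w <= dmap f a i q)%MS by rewrite (eqmxP dW).
have ov' : forall b c, inner i (f q) (v b) (v c) = (b == c)%:R by rewrite qp.
have := sp a i q aq fqi v vD ov' w wD; rewrite qp -(eqmxP vD) => /submxP[D sE].
have Vz : \matrix_s v s *m metric i x *m z^T = 0.
  apply/row_matrixP => s; rewrite row0 !row_mul rowK; apply/matrixP => b c.
  by rewrite !ord1 [RHS]mxE; exact: vz.
have -> : \sum_b T (v b) w (v b) z = ip (\sum_b Rm i p (v b) w (v b)) z.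
  rewrite /bilin mulmx_suml mulmx_suml summxE; apply: eq_bigr => s _.
  by rewrite RmE.
by rewrite sE /bilin -!mulmxA (mulmxA _ (metric i x)) Vz mulmx0 mxE.
Qed.

Lemma frame_nth s a b : frame s -> (a < size s)%N -> (b < size s)%N ->
  ip s`_a s`_b = (a == b)%:R /\ ip (J s`_a) s`_b = 0.
Proof.
move=> /andP[/allP s1 /(pairwiseP 0) s2] a_s b_s.
have lt c d : (c < size s)%N -> (d < size s)%N -> (c < d)%N ->
    ip s`_c s`_d = 0 /\ ip (J s`_c) s`_d = 0.
  by move=> cs ds cd; have /andP[/eqP-> /eqP->] := s2 c d cs ds cd.
case: (ltngtP a b) => [ab|ba|<-].
- by have [-> ->] := lt a b a_s b_s ab.
- have [E1 E2] := lt b a b_s a_s ba.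
  by rewrite (ip_sym HS) E1 (ip_Jl HS) (ip_sym HS) E2 oppr0.
- by have /eqP-> := s1 _ (mem_nth 0 a_s); rewrite (ip_Jself HS).
Qed.

Lemma antiholomorphic_sum r s w z : axiom_special_antiholomorphic M r ->
  size s = r -> frame s -> w \in s -> (forall y, y \in s -> ip y z = 0) ->
  \sum_(y <- s) T y w y z = 0.
Proof.
move=> ax sr fs ws sz; pose v (a : 'I_r) := s`_a.
have ov a b : inner i p (v a) (v b) = (a == b)%:R.
  by have [] := @frame_nth s a b fs; rewrite ?sr.
have sV y : y \in s -> (y <= \matrix_a v a)%MS.
  move=> /(nthP 0)[a a_s <-]; have ar : (a < r)%N by rewrite -sr.
  by rewrite (_ : s`_a = row (Ordinal ar) (\matrix_a v a)) ?row_sub // rowK.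
pose W : 'M_n := <<\matrix_a v a>>%MS.
have Wr : \rank W = r by rewrite genmxE (orthonormal_rank ov).
have hW : antiholomorphic i p W.
  move=> u u'; rewrite !genmxE => uW u'W.
  have := @bilin_span _ _ _ (cplx i x *m metric i x) v u u' _ uW u'W.
  rewrite /inner /bilin !mulmxA; apply=> a b; rewrite /bilin !mulmxA.
  by have [] := @frame_nth s a b fs; rewrite ?sr.
have vW : (\matrix_a v a == W)%MS by apply/eqmxP/eqmx_sym; exact: genmxE.
have wW : (w <= W)%MS by rewrite genmxE sV.
have vz (a : 'I_r) : ip (v a) z = 0 by apply: sz; rewrite mem_nth // sr.
rewrite (big_nth 0) sr big_mkord.
exact: (special_sum (ax p i ip_dom W Wr hW) vW ov wW vz).
Qed.

(** The vectors y_0, J y_0, y_1, J y_1, ... form an orthonormal basis of a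
    holomorphic subspace. *)
Lemma holomorphic_sum r s w z : axiom_special_holomorphic M r ->
  size s = r -> frame s -> w \in s ->
  (forall y, y \in s -> ip y z = 0 /\ ip (J y) z = 0) ->
  \sum_(y <- s) (T y w y z + T (J y) w (J y) z) = 0.
Proof.
move=> ax sr fs ws sz.
pose v0 (a : nat) := if odd a then J s`_(a./2) else s`_(a./2).
pose v (a : 'I_(2 * r)) := v0 a.
have half_lt (a : 'I_(2 * r)) : (a./2 < size s)%N.
  by rewrite sr ltn_half_double -mul2n.
have ov a b : inner i p (v a) (v b) = (a == b)%:R.
  have [E1 E2] := frame_nth fs (half_lt a) (half_lt b).
  have [_ E3] := frame_nth fs (half_lt b) (half_lt a).
  rewrite -val_eqE /= -[val a]odd_double_half -[val b]odd_double_half.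
  rewrite /inner /v /v0; case: (odd a); case: (odd b) => /=.
  - by rewrite (ip_JJ HS) E1 !add1n eqSS -!mul2n eqn_mul2l.
  - rewrite E2; case: eqP => // /(congr1 odd).
    by rewrite ?oddD /= ?odd_double.
  - rewrite (ip_sym HS) E3; case: eqP => // /(congr1 odd).
    by rewrite ?oddD /= ?odd_double.
  - by rewrite E1 -!mul2n eqn_mul2l.
pose A := \matrix_a v a.
have vA (a : nat) : (a < 2 * r)%N -> (v0 a <= A)%MS.
  move=> ar; rewrite (_ : v0 a = row (Ordinal ar) A) ?row_sub //.
  by rewrite rowK.
have AJ : (A *m cplx i x <= A)%MS.
  apply/row_subP => a; rewrite row_mul rowK.
  have [oa|oa] := boolP (odd a).
    have aE : (a : nat) = (a./2).*2.+1 by rewrite -{1}[val a]odd_double_half oa.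
    have -> : v a *m cplx i x = - v0 (a./2).*2.
      by rewrite /v {1}aE /v0 /= odd_double /= uphalf_double doubleK; exact: (JJ HS).
    by rewrite eqmx_opp vA // (leq_trans _ (ltn_ord a)) // {2}aE.
  have aE : (a : nat) = (a./2).*2.
    by rewrite -{1}[val a]odd_double_half (negbTE oa).
  have -> : v a *m cplx i x = v0 (a./2).*2.+1.
    by rewrite /v {1}aE /v0 /= odd_double /= uphalf_double doubleK.
  apply: vA; move: (half_lt a); rewrite sr; move: (a./2) => h hr.
  by rewrite mul2n ltn_Sdouble.
pose W : 'M_n := <<A>>%MS.
have Wr : \rank W = (2 * r)%N by rewrite genmxE (orthonormal_rank ov).
have WJ : (W *m cplx i x <= W)%MS.
  by rewrite (eqmxMr _ (genmxE A)) genmxE.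
have hW : holomorphic i p W.
  rewrite /holomorphic WJ /=.
  have := submxMr (cplx i x) WJ.
  by rewrite -mulmxA cplx_sqr // mulmxN mulmx1 eqmx_opp.
have vW : (A == W)%MS by apply/eqmxP/eqmx_sym; exact: genmxE.
have wW : (w <= W)%MS.
  rewrite genmxE; move: ws => /(nthP 0)[a a_s <-].
  have := vA a.*2; rewrite /v0 odd_double doubleK; apply.
  by rewrite mul2n ltn_double -sr.
have vz (a : 'I_(2 * r)) : ip (v a) z = 0.
  have [E1 E2] := sz _ (mem_nth 0 (half_lt a)).
  by rewrite /v /v0; case: ifP.
rewrite (big_nth 0) sr big_mkord.
rewrite -[RHS](special_sum (ax p i ip_dom W Wr hW) vW ov wW vz).
rewrite (big_double r (fun a => T (v0 a) w (v0 a) z)).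
apply: eq_bigr => a _.
by rewrite /v0 /= odd_double /= doubleK uphalf_double.
Qed.

End SpecialPoint.

(** * Constant holomorphic curvature *)

Section PointwiseConstancy.
Context {R : realType} {n : nat} {M : kahler R n} (i : Defs.index M) (p : M).
Context (ip_dom : dom i p).
Implicit Types (e u v w y z : 'rV[R]_n) (s : seq 'rV[R]_n).

Local Notation x := (chart i p).
Local Notation ip := (bilin (metric i x)).
Local Notation J := (fun u => u *m cplx i x).
Local Notation curv := (curv_mx (lc M) i).
Local Notation T := (fun a b c d => ip (c *m curv a b x) d).
Local Notation frame := (frame ip J).

Let Ux : cod i x := cod_chart ip_dom.
Let HS := hermitian_at Ux.
Let HT := kahler_tensor_at Ux.

(** A frame of N + 2 vectors can be prolonged as long as 2 (N + 2) < n: a new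
    vector must be orthogonal to the old ones and to their images under J. *)
Lemma frame_extend N e y : (2 * N.+2 <= n)%N -> frame [:: e; y] ->
  exists2 ys, size ys = N & frame [:: e, y & ys].
Proof.
elim: N => [|N IH] Nn ey; first by exists [::].
have [|ys ysN eyys] := IH _ ey; first by lia.
pose s := [:: e, y & ys].
have [|v v0 vs] := @orthogonal_exists R n (metric i x) (s ++ map J s).
  by rewrite size_cat size_map /= ysN; move: Nn; lia.
have vv := Defs.metric_pos Ux v0.
pose k := (Num.sqrt (ip v v))^-1.
have kv : ip (k *: v) (k *: v) = 1.
  by rewrite !(ipE HS) mulrA -expr2 exprVn sqr_sqrtr ?mulVf ?ltW // gt_eqF.
have us z : z \in s -> uorth ip J z (k *: v).
  move=> zs; rewrite /uorth !(ipE HS) !(ip_sym HS _ v) !vs ?mulr0 ?eqxx //.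
    by rewrite mem_cat (map_f J zs) orbT.
  by rewrite mem_cat zs.
exists (k *: v :: ys); first by rewrite /= ysN.
move: eyys; rewrite !frame_cons /= => /and5P[-> /andP[-> ->] -> -> ->].
rewrite kv eqxx !us ?inE ?eqxx ?orbT //= andbT.
by apply/allP => z zys; rewrite (uorth_sym HS) us // !inE zys !orbT.
Qed.

(** The proportionality constant is read off at an arbitrary nonzero vector. *)
Lemma holcurv_constant_at : (0 < n)%N ->
  (forall e u, bisec J T u u u u * ip e e ^+ 2 =
               bisec J T e e e e * ip u u ^+ 2) ->
  exists k, forall u, holcurv i u x = 4 * k * ip u u ^+ 2.
Proof.
move=> n0 hF; pose e : 'rV[R]_n := const_mx 1.
have e0 : e != 0.
  apply/eqP => /rowP/(_ (Ordinal n0)); rewrite !mxE => /eqP.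
  by rewrite oner_eq0.
have ee : ip e e != 0 by rewrite gt_eqF // Defs.metric_pos.
exists (- bisec J T e e e e / (4 * ip e e ^+ 2)) => u.
have -> : holcurv i u x = - bisec J T u u u u.
  by rewrite /bisec /=; have := T_anti12 HT (J u) u (J u) u; rewrite /= => ->; rewrite opprK.
have -> : bisec J T u u u u = bisec J T e e e e * ip u u ^+ 2 / ip e e ^+ 2.
  by rewrite -hF mulfK // expf_neq0.
by field.
Qed.

End PointwiseConstancy.

Section Main.
Context {R : realType}.

Lemma axiom_holcurv_constant_at m (M : kahler R (2 * m)) : (2 <= m)%N ->
  (exists2 r : nat, (1 <= r <= m - 1)%N & axiom_special_holomorphic M r) \/
  (exists2 r : nat, (2 <= r <= m)%N & axiom_special_antiholomorphic M r) ->
  forall (i : Defs.index M) p, dom i p ->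
  exists k, forall u, holcurv i u (chart i p) =
    4 * k * bilin (metric i (chart i p)) u u ^+ 2.
Proof.
move=> m2 ax i p ip.
apply: (holcurv_constant_at ip); first by rewrite muln_gt0 (leq_trans _ m2).
have HS := hermitian_at (cod_chart ip); have HT := kahler_tensor_at (cod_chart ip).
case: ax => [[[|r] // rm ax]|[[|[|r]] // rm ax]].
- apply: (bisec_constant_of_holomorphic HS HT (N := r)).
    move=> e y; apply: frame_extend => //.
    by rewrite leq_mul2l /=; lia.
  by move=> s w z; apply: holomorphic_sum.
- apply: (bisec_constant_of_antiholomorphic HS HT (N := r)).
    move=> e y; apply: frame_extend => //.
    by rewrite leq_mul2l /=; lia.
  by move=> s w z; apply: antiholomorphic_sum.
Qed.


Lemma holcurv_change n (M : kahler R n) (i j : Defs.index M) p u :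
  dom i p -> dom j p ->
  holcurv j (u *m change i j p) (chart j p) = holcurv i u (chart i p).
Proof.
move=> ip jp; rewrite /holcurv.
have -> : u *m change i j p *m cplx j (chart j p) =
    u *m cplx i (chart i p) *m change i j p.
  by rewrite -mulmxA -cplx_change // mulmxA.
by rewrite -(mulmxA _ (change i j p)) -curv_mx_change // mulmxA metric_change.
Qed.

Lemma holcurv_uniq n (M : kahler R n) (i j : Defs.index M) p (k l : R) :
  (0 < n)%N -> dom i p -> dom j p ->
  (forall u, holcurv i u (chart i p) =
     4 * k * bilin (metric i (chart i p)) u u ^+ 2) ->
  (forall u, holcurv j u (chart j p) =
     4 * l * bilin (metric j (chart j p)) u u ^+ 2) -> k = l.
Proof.
move=> n0 ip jp hk hl; pose e : 'rV[R]_n := const_mx 1.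
have e0 : e != 0.
  apply/eqP => /rowP/(_ (Ordinal n0)); rewrite !mxE => /eqP.
  by rewrite oner_eq0.
have ee : bilin (metric i (chart i p)) e e != 0.
  by rewrite gt_eqF // Defs.metric_pos //; exact: cod_chart.
have := hk e; rewrite -(holcurv_change e ip jp) hl (metric_change ip jp).
move=> /(mulIf (expf_neq0 2 ee)); lra.
Qed.

(** The level sets of a locally constant function are open and closed. *)
Lemma locally_constant_connected (X : topologicalType) (Y : Type) (f : X -> Y) :
  connected [set: X] -> (forall p, \forall q \near p, f q = f p) ->
  forall p q, f p = f q.
Proof.
move=> cX fX p q; pose B := [set z | f z = f p].
have oB : open B.
  rewrite openE => z /= zp; apply: (filterS _ (fX z)) => w wz; rewrite /B /= wz; exact: zp.
have cB : closed B.
  have oC : open (~` B).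
    rewrite openE => a aB; apply: (filterS _ (fX a)) => b ba.
    by rewrite /setC /B /= ba.
  by rewrite -[B]setCK; exact: open_closedC.
have BT : B = setT; last first.
  have Bq : B q by rewrite BT.
  exact: esym Bq.
apply: cX; first by exists p.
  by exists B; rewrite ?setTI.
by exists B; rewrite ?setTI.
Qed.


(** A constant k at each point and in each chart gives a function on M: by
    [holcurv_change] it does not depend on the chart, by [schur] it is locally
    constant in a chart. *)
Theorem kahler_schur m (M : kahler R (2 * m)) : (2 <= m)%N ->
  connected [set: M] ->
  (forall (i : Defs.index M) p, dom i p ->
    exists k, forall u, holcurv i u (chart i p) =
      4 * k * bilin (metric i (chart i p)) u u ^+ 2) ->
  constant_holomorphic_curvature M.
Proof.
move=> m2 cM hM; have n0 : (0 < 2 * m)%N by lia.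
pose P (i : Defs.index M) (x : 'rV[R]_(2 * m)) (k : R) :=
  cod i x -> forall u, holcurv i u x = 4 * k * bilin (metric i x) u u ^+ 2.
have Pex i x : exists k, P i x k.
  have [[p ip <-]|nx] := pselect (cod i x).
    by have [k hk] := hM i p ip; exists k => _.
  by exists 0 => /nx.
pose K i := projT1 (boolp.choice (Pex i)).
have hK i x : P i x (K i x) := projT2 (boolp.choice (Pex i)) x.
have hKp i p (ip : dom i p) := hK i _ (cod_chart ip).
have [ch chP] := boolp.choice (@dom_cover _ _ M).
pose f (p : M) := K (ch p) (chart (ch p) p).
have fE i p : dom i p -> f p = K i (chart i p).
  by move=> ip; apply: (holcurv_uniq n0 (chP p) ip); exact: hKp.
have loc p : \forall q \near p, f q = f p.
  have ip := chP p; set i := ch p in ip *; set x := chart i p.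
  have Ux : cod i x by exact: cod_chart.
  have [r r0 rU] : exists2 r, 0 < r & ball x r `<=` cod i.
    by apply/nbhs_ballP/open_nbhs_nbhs; split => //; exact: open_cod.
  have Kx : forall y, ball x r y -> K i y = K i x.
    apply: derive0_ball_constant => y u /rU Uy.
    by apply: (schur _ (hK i)) => //; lia.
  have n1 : nbhs p (dom i) by apply: open_nbhs_nbhs; split => //; exact: dom_open.
  have n2 : nbhs p (chart i @^-1` ball x r).
    by apply: (chart_continuous ip); exact: nbhsx_ballx.
  apply: (filterS _ (filterI n1 n2)) => q [iq /Kx].
  by rewrite (fE i q iq) (fE i p ip).
have fc := locally_constant_connected cM loc.
have [[p0 _]|none] := pselect (exists p : M, True); last first.
  by exists 0 => i p; case: none; exists p.
(* The model tensor has holomorphic sectional curvature 4. *)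
exists (4 * f p0) => i p ip u u0.
have HS := hermitian_at (cod_chart ip).
rewrite (fc p0 p) (fE i p ip) /sectional /inner RmE //.
rewrite -/(holcurv i u (chart i p)) (hKp i p ip).
rewrite (cplx_hermitian (cod_chart ip)).
have -> : bilin (metric i (chart i p)) u (u *m Jmx i p) = 0.
  by rewrite (ip_sym HS); exact: (ip_Jself HS).
have /lt0r_neq0 := Defs.metric_pos (cod_chart ip) u0.
by move=> uu; field.
Qed.

(** In R(v,w)v for the model tensor, the term with <Jv,v> drops out, and the
    remaining ones are multiples of v, w and Jv. *)
Theorem constant_very_special n (M : kahler R n) :
  constant_holomorphic_curvature M ->
  forall (k : nat) (S : riemannian R k) (f : S -> M),
    complex_immersion f \/ totally_real f -> very_special f.
Proof.
move=> [c hc] k S f hf a i q aq iq v w vW wW.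
have Ux := cod_chart iq; have HS := hermitian_at Ux.
have hk u : holcurv i u (chart i (f q)) =
    4 * (c / 4) * bilin (metric i (chart i (f q))) u u ^+ 2.
  have [->|u0] := eqVneq u 0.
    by rewrite /holcurv !mul0mx !(ip0l HS) expr0n mulr0.
  have := hc i (f q) iq u u0; rewrite /sectional /inner RmE //.
  rewrite -/(holcurv i u (chart i (f q))) (cplx_hermitian Ux).
  have -> : bilin (metric i (chart i (f q))) u (u *m Jmx i (f q)) = 0.
    by rewrite (ip_sym HS); exact: (ip_Jself HS).
  have /lt0r_neq0 uu := Defs.metric_pos Ux u0.
  by move=> <-; field.
rewrite RmE // (curv_mx_of_holcurv Ux hk) -scalemxAr scalemx_sub // mul_model_mx //.
have Jv : bilin (metric i (chart i (f q))) (v *m cplx i (chart i (f q))) v = 0.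
  exact: (ip_Jself HS).
rewrite /model_curv Jv scale0r subr0.
have sub4 A B C E : (A <= dmap f a i q)%MS -> (B <= dmap f a i q)%MS ->
    (C <= dmap f a i q)%MS -> (E <= dmap f a i q)%MS ->
    (A - B + C - E <= dmap f a i q)%MS.
  by move=> *; rewrite !addmx_sub ?eqmx_opp.
case: hf => [hol|tr].
  have vJ : (v *m cplx i (chart i (f q)) <= dmap f a i q)%MS.
    have /andP[h _] := hol a i q aq iq.
    exact: submx_trans (submxMr _ vW) h.
  by apply: sub4; rewrite ?scalemx_sub.
have Jvw : bilin (metric i (chart i (f q))) (v *m cplx i (chart i (f q))) w = 0.
  exact: tr a i q aq iq v w vW wW.
have Jwv : bilin (metric i (chart i (f q))) (w *m cplx i (chart i (f q))) v = 0.
  exact: tr a i q aq iq w v wW vW.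
by apply: sub4; rewrite ?Jvw ?Jwv ?mulr0 ?scale0r ?sub0mx ?scalemx_sub.
Qed.

End Main.

Unset Implicit Arguments.

Theorem theorem1p2 (R : realType) :
  (forall (m : nat) (M : kahler R (2 * m)),
     (2 <= m)%N ->
     connected [set: M] ->
     (exists2 r : nat, (1 <= r <= m - 1)%N & axiom_special_holomorphic M r) \/
     (exists2 r : nat, (2 <= r <= m)%N & axiom_special_antiholomorphic M r) ->
     constant_holomorphic_curvature M)
  /\
  (forall (m : nat) (M : kahler R (2 * m)),
     constant_holomorphic_curvature M ->
     forall (k : nat) (S : riemannian R k) (f : S -> M),
       isometric_immersion f ->
       complex_immersion f \/ totally_real f ->
       very_special f).
Proof.
split=> [m M m2 cM ax|m M hM k S f _].
  exact: kahler_schur m2 cM (axiom_holcurv_constant_at m2 ax).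
exact: constant_very_special hM k S f.
Qed.
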